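(* There is an algorithm that, given a set $S=\{A_1,\dots,A_m\}$ of real $n\times n$ matrices each satisfying $A\mathbf{1}=\mathbf{1}$ and $\|Ax\|_{\mathcal{P}}\le\|x\|_{\mathcal{P}}$ for all $x\in\mathbb{R}^n$, decides each of the following two problems using $O(3^n m n^2)$ operations: (Problem 1) whether the switched system $x(t+1)=A_{\sigma(t)}x(t)$, $x(0)=x_0$, converges to a multiple of $\mathbf{1}$ for every $x_0\in\mathbb{R}^n$ and every $\sigma:\mathbb{N}\to\{1,\dots,m\}$; (Problem 2) whether there exists a sequence $\sigma:\mathbb{N}\to\{1,\dots,m\}$ such that for every $x_0\in\mathbb{R}^n$ the trajectory converges to a multiple of $\mathbf{1}$.
   Context: $\mathbf{1}=(1,\dots,1)^\top\in\mathbb{R}^n$ and $\|x\|_{\mathcal{P}}=\tfrac12(\max_i x_i-\min_i x_i)$. Operations are arithmetic operations and comparisons on real numbers. *)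

(* Defs.v *)
From HB Require Import structures.
From mathcomp Require Import all_boot all_order all_algebra.
From mathcomp Require Import all_classical all_reals all_analysis.
Set Implicit Arguments. Unset Strict Implicit. Unset Printing Implicit Defensive.
Import Order.TTheory GRing.Theory Num.Theory.
Local Open Scope classical_set_scope.
Local Open Scope ring_scope.

(* ||x||_P = (max_i x_i - min_i x_i)/2, written as (max_{i,j} (x_i - x_j))/2;
   the seed 0 is harmless since the i = j terms are 0 (and n = 0 gives 0). *)
Definition pnorm (R : realType) (n : nat) (x : 'cV[R]_n) : R :=
  (\big[Num.max/0]_(i < n) \big[Num.max/0]_(j < n) (x i ord0 - x j ord0)) / 2.

Definition ones (R : realType) (n : nat) : 'cV[R]_n := const_mx 1.

Definition admissible (R : realType) (n : nat) (A : 'M[R]_n) : Prop :=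
  A *m ones R n = ones R n /\ forall x : 'cV[R]_n, pnorm (A *m x) <= pnorm x.

Fixpoint traj (R : realType) (n m : nat) (A : 'I_m -> 'M[R]_n)
  (sigma : nat -> 'I_m) (x0 : 'cV[R]_n) (t : nat) : 'cV[R]_n :=
  match t with
  | 0 => x0
  | t'.+1 => A (sigma t') *m traj A sigma x0 t'
  end.

Definition conv_to_consensus (R : realType) (n : nat) (x : nat -> 'cV[R]_n) : Prop :=
  exists c : R, forall i : 'I_n, (fun t => (x t i ord0 : R^o)) @ \oo --> (c : R^o).

Definition problem1 (R : realType) (n m : nat) (A : 'I_m -> 'M[R]_n) : Prop :=
  forall (x0 : 'cV[R]_n) (sigma : nat -> 'I_m), conv_to_consensus (traj A sigma x0).

Definition problem2 (R : realType) (n m : nat) (A : 'I_m -> 'M[R]_n) : Prop :=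
  exists sigma : nat -> 'I_m, forall x0 : 'cV[R]_n, conv_to_consensus (traj A sigma x0).

(* ---------- The model of computation: a real RAM (BSS-style machine) ----------
   Real registers r : nat -> R, natural-number (index) registers N : nat -> nat.
   Every executed instruction costs one step.  Constants are integers only. *)
Inductive instr : Type :=
| RConst (d : nat) (c : int)
| RAdd (d a b : nat)
| RSub (d a b : nat)
| RMul (d a b : nat)
| RDiv (d a b : nat)                  (* r d := r a / r b  (x/0 = 0) *)
| RLoad (d a : nat)
| RStore (a s : nat)
| NConst (d k : nat)
| NAdd (d a b : nat)
| NSub (d a b : nat)                  (* N d := N a - N b (truncated) *)
| JLeR (a b t : nat)
| JLeN (a b t : nat)
| Jmp (t : nat)
| Halt (out : bool).

Definition program := seq instr.

Record config (R : realType) := Config {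
  pc : nat; rreg : nat -> R; nreg : nat -> nat }.

Definition upd {T : Type} (f : nat -> T) (k : nat) (v : T) : nat -> T :=
  fun j => if j == k then v else f j.

Definition exec (R : realType) (i : instr) (c : config R) : config R :=
  let r := rreg c in let N := nreg c in let p := pc c in
  match i with
  | RConst d k => Config p.+1 (upd r d (k%:~R)) N
  | RAdd d a b => Config p.+1 (upd r d (r a + r b)) N
  | RSub d a b => Config p.+1 (upd r d (r a - r b)) N
  | RMul d a b => Config p.+1 (upd r d (r a * r b)) N
  | RDiv d a b => Config p.+1 (upd r d (r a / r b)) N
  | RLoad d a => Config p.+1 (upd r d (r (N a))) N
  | RStore a s => Config p.+1 (upd r (N a) (r s)) N
  | NConst d k => Config p.+1 r (upd N d k)
  | NAdd d a b => Config p.+1 r (upd N d (N a + N b)%N)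
  | NSub d a b => Config p.+1 r (upd N d (N a - N b)%N)
  | JLeR a b t => Config (if r a <= r b then t else p.+1) r N
  | JLeN a b t => Config (if (N a <= N b)%N then t else p.+1) r N
  | Jmp t => Config t r N
  | Halt _ => c
  end.

(* run for at most 'fuel' steps; Some b iff the machine executes Halt b
   within 'fuel' steps (the Halt instruction itself counts as a step). *)
Fixpoint run (R : realType) (P : program) (fuel : nat) (c : config R) : option bool :=
  match fuel with
  | 0 => None
  | f.+1 =>
    match onth P (pc c) with
    | None => None
    | Some (Halt b) => Some b
    | Some i => run P f (exec i c)
    end
  end.

Definition encodes (R : realType) (n m : nat) (A : 'I_m -> 'M[R]_n) (c : config R) : Prop :=
  [/\ pc c = 0%N,
      [/\ nreg c 0 = n, nreg c 1 = m & (forall k, (1 < k)%N -> nreg c k = 0%N)],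
      (forall (k : 'I_m) (i j : 'I_n), rreg c (k * n * n + i * n + j)%N = A k i j)
    & (forall a, (m * n * n <= a)%N -> rreg c a = 0)].

Definition decides_within (R : realType) (P : program)
  (Q : forall n m, ('I_m -> 'M[R]_n) -> Prop) (bound : nat -> nat -> nat) : Prop :=
  forall (n m : nat) (A : 'I_m -> 'M[R]_n), (0 < n)%N -> (0 < m)%N ->
    (forall k, admissible (A k)) ->
    forall c : config R, encodes A c ->
      exists b : bool, run P (bound n m) c = Some b /\ (b = true <-> Q n m A).

(* Main.v *)
(* The unit ball of [pnorm] is a polytope, and an admissible matrix maps the relative
   interior of each of its faces into the relative interior of a single face, or into the
   interior of the ball.  The faces are encoded by vectors with entries 0, 1, -1, hence by
   numbers below 3 ^ n, the number 0 standing for the interior; the matrices thus act on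
   these numbers as a finite automaton with sink 0.  Problem 1 holds iff every path of the
   automaton reaches 0, and problem 2 holds iff every vertex has some path to 0 (words
   killing the vertices one at a time can be concatenated, and then repeated).  Both are
   decided by peeling the graph backward from 0: a vertex is peeled once all (problem 1),
   respectively one (problem 2), of its out-neighbours are, and the answer is whether every
   vertex gets peeled.  Each of the 3 ^ n * m edges costs one matrix-vector product.
   Natural-number registers cannot be addressed indirectly, so vertices live in real
   registers and are converted to addresses through their base 3 digits in O(n) steps;
   this is also why adjacency is stored as linked lists inside a 3 ^ n by 3 ^ n table. *)

Require Import Defs.
From HB Require Import structures.
From mathcomp Require Import all_boot all_order all_algebra.
From mathcomp Require Import all_classical all_reals all_analysis.
From mathcomp Require Import zify ring lra.
Set Implicit Arguments. Unset Strict Implicit. Unset Printing Implicit Defensive.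
Import Order.TTheory GRing.Theory Num.Theory numFieldNormedType.Exports.
Local Open Scope classical_set_scope.
Local Open Scope ring_scope.

(** * Structured programs on the real RAM *)

(** A face is determined by its tight pairs, the i, j with x_i - x_j = 2; that a matrix respects
    them is pure convexity, so matrices with negative entries are covered. Numbers below 3 ^ n that
    are not codes of faces do no harm: [dvec u] lies in the ball for every [u], so they are
    additional starting vertices without incoming edges. Finiteness turns reachability into a rate.
    A word sending every number to 0 maps the finitely many [dvec u] into the open ball, and the
    largest seminorm among the images is a contraction factor below 1. The adjacency table has 9 ^ n
    cells, too many to be cleared within the bound. All registers outside the input start at zero,
    and the encodings are chosen so that zero means empty list, absent edge, counter at zero and, in
    the queue, the sink. Parallel edges are stored once, as each vertex leaves the queue only once;
    the traversal cost is then amortised over at most 3 ^ n * m distinct edges. *)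

Inductive cmd : Type :=
| Blk (l : program)
| Sq (c1 c2 : cmd)
| IfR (a b : nat) (c1 c2 : cmd)
| WhR (a b : nat) (c : cmd)
| WhN (a b : nat) (c : cmd).

Fixpoint csize (c : cmd) : nat :=
  match c with
  | Blk l => size l
  | Sq c1 c2 => csize c1 + csize c2
  | IfR _ _ c1 c2 => (csize c1 + csize c2).+2
  | WhR _ _ c | WhN _ _ c => (csize c).+2
  end.

(** Jump targets are absolute, hence the start address [p]. The conditional instructions jump on
    [<=], so the else-branch is laid out first, and [WhR a b], [WhN a b] loop while register [b] is
    strictly below register [a]. *)
Fixpoint compile (c : cmd) (p : nat) : program :=
  match c with
  | Blk l => l
  | Sq c1 c2 => compile c1 p ++ compile c2 (p + csize c1)
  | IfR a b c1 c2 =>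
      (JLeR a b (p + csize c2).+2 :: compile c2 p.+1) ++
      Jmp (p + csize c1 + csize c2).+2 :: compile c1 (p + csize c2).+2
  | WhR a b c =>
      (JLeR a b (p + csize c).+2 :: compile c p.+1) ++ [:: Jmp p]
  | WhN a b c =>
      (JLeN a b (p + csize c).+2 :: compile c p.+1) ++ [:: Jmp p]
  end.

Lemma size_compile c p : size (compile c p) = csize c.
Proof.
elim: c p => //= [c1 IH1 c2 IH2|a b c1 IH1 c2 IH2|a b c IH|a b c IH] p;
  rewrite /= size_cat /= ?IH1 ?IH2 ?IH /=; lia.
Qed.

Definition basic (i : instr) : bool :=
  match i with JLeR _ _ _ | JLeN _ _ _ | Jmp _ | Halt _ => false | _ => true end.

Definition embedded (l P : program) (p : nat) : Prop :=
  exists pre post, P = pre ++ l ++ post /\ size pre = p.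

Lemma embedded_cat l1 l2 P p : embedded (l1 ++ l2) P p ->
  embedded l1 P p /\ embedded l2 P (p + size l1).
Proof.
move=> [pre [post [-> <-]]]; split; first by exists pre, (l2 ++ post); rewrite -!catA.
by exists (pre ++ l1), post; rewrite -!catA size_cat.
Qed.

Lemma embedded_cons i l P p : embedded (i :: l) P p ->
  onth P p = Some i /\ embedded l P p.+1.
Proof.
move=> [pre [post [-> <-]]]; split.
  by rewrite onthE map_cat nth_cat size_map ltnn subnn.
by exists (rcons pre i), post; rewrite cat_rcons size_rcons.
Qed.

Section Logic.
Variable R : realType.

Definition state : Type := ((nat -> R) * (nat -> nat))%type.

Definition cfg (p : nat) (s : state) : config R := Config p s.1 s.2.

Definition step (i : instr) (s : state) : state :=
  let c := exec i (cfg 0 s) in (rreg c, nreg c).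

Definition exec_blk (l : program) (s : state) : state :=
  foldl (fun s i => step i s) s l.

(** Quantifying over the enclosing program makes code relocatable; quantifying over the leftover
    fuel [f] makes costs add up under sequencing. *)
Definition steps (c : cmd) (s : state) (t : nat) (s' : state) : Prop :=
  forall P p, embedded (compile c p) P p ->
  forall f, run P (t + f) (cfg p s) = run P f (cfg (p + csize c) s').

Definition W (c : cmd) (s : state) (t : nat) (Q : state -> Prop) : Prop :=
  exists t' s', [/\ (t' <= t)%N, Q s' & steps c s t' s'].

Lemma W_impl c s t t' (Q Q' : state -> Prop) :
  W c s t Q -> (t <= t')%N -> (forall s, Q s -> Q' s) -> W c s t' Q'.
Proof.
move=> [u [s' [ut Qs st]]] tt' QQ'; exists u, s'.
by split; [exact: leq_trans tt' | exact: QQ' |].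
Qed.

Lemma run_basic P p i s f : onth P p = Some i -> basic i ->
  run P f.+1 (cfg p s) = run P f (cfg p.+1 (step i s)).
Proof. by move=> /= ->; case: i. Qed.

Lemma run_jler P p a b q s f : onth P p = Some (JLeR a b q) ->
  run P f.+1 (cfg p s) = run P f (cfg (if s.1 a <= s.1 b then q else p.+1) s).
Proof. by move=> /= ->. Qed.

Lemma run_jlen P p a b q s f : onth P p = Some (JLeN a b q) ->
  run P f.+1 (cfg p s) =
  run P f (cfg (if (s.2 a <= s.2 b)%N then q else p.+1) s).
Proof. by move=> /= ->. Qed.

Lemma run_jmp P p q s f : onth P p = Some (Jmp q) ->
  run P f.+1 (cfg p s) = run P f (cfg q s).
Proof. by move=> /= ->. Qed.

Lemma run_halt P p b s f : onth P p = Some (Halt b) -> run P f.+1 (cfg p s) = Some b.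
Proof. by move=> /= ->. Qed.

Arguments run : simpl never.

Lemma W_blk l s t (Q : state -> Prop) :
  all basic l -> (size l <= t)%N -> Q (exec_blk l s) -> W (Blk l) s t Q.
Proof.
move=> lb lt Qs; exists (size l), (exec_blk l s); split=> // P p /=.
elim: l p s lb {lt Qs} => [|i l IH] p s /=; first by rewrite addn0.
move=> /andP[ib lb] /embedded_cons[Pi emb] f.
rewrite addSn (run_basic _ _ Pi) // IH // addSnnS //.
Qed.

Lemma W_seq c1 c2 s t t1 t2 (Q1 Q : state -> Prop) :
  W c1 s t1 Q1 -> (forall s1, Q1 s1 -> W c2 s1 t2 Q) -> (t1 + t2 <= t)%N ->
  W (Sq c1 c2) s t Q.
Proof.
move=> [u1 [s1 [ut1 /[swap] st1 Q1s /(_ _ Q1s)]]] [u2 [s2 [ut2 Qs st2]]] tt.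
exists (u1 + u2)%N, s2; split=> //; first by lia.
move=> P p /= /embedded_cat[e1]; rewrite size_compile => e2 f.
by rewrite -addnA st1 // st2 // addnA.
Qed.

Lemma W_ifr a b c1 c2 s t (Q : state -> Prop) :
  (s.1 a <= s.1 b -> W c1 s t Q) -> (s.1 b < s.1 a -> W c2 s t Q) ->
  W (IfR a b c1 c2) s t.+2 Q.
Proof.
case: (leP (s.1 a) (s.1 b)) => ab.
- move=> /(_ isT)[u [s' [ut Qs st]]] _; exists u.+1, s'; split=> //; first by lia.
  move=> P p /= /(@embedded_cat (_ :: _))[/embedded_cons[P0 _]] /=.
  rewrite size_compile => /embedded_cons[_].
  rewrite (_ : (p + (csize c2).+1).+1 = (p + csize c2).+2); last by lia.
  move=> e f; rewrite (_ : u.+1 + f = (u + f).+1)%N //.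
  rewrite (run_jler _ _ P0) ab st //.
  by congr (run _ _ (cfg _ _)); lia.
- move=> _ /(_ isT)[u [s' [ut Qs st]]]; exists u.+2, s'; split=> //.
  move=> P p /= /(@embedded_cat (_ :: _))[/embedded_cons[P0 e]] /=.
  rewrite size_compile => /embedded_cons[P1 _] f.
  rewrite (_ : u.+2 + f = (u + f.+1).+1)%N; last by lia.
  rewrite (run_jler _ _ P0) leNgt ab /= st //.
  rewrite (run_jmp (q := (p + csize c1 + csize c2).+2)) ?addSnnS //.
  by congr (run _ _ (cfg _ _)); lia.
Qed.

Lemma W_whr_exit a b c s t (Q : state -> Prop) :
  s.1 a <= s.1 b -> Q s -> (0 < t)%N -> W (WhR a b c) s t Q.
Proof.
move=> ab Qs t0; exists 1, s; split=> // P p /= /embedded_cons[P0 _] f.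
rewrite add1n (run_jler _ _ P0) ab; by congr (run _ _ (cfg _ _)); lia.
Qed.

Lemma W_whn_exit a b c s t (Q : state -> Prop) :
  (s.2 a <= s.2 b)%N -> Q s -> (0 < t)%N -> W (WhN a b c) s t Q.
Proof.
move=> ab Qs t0; exists 1, s; split=> // P p /= /embedded_cons[P0 _] f.
rewrite add1n (run_jlen _ _ P0) ab; by congr (run _ _ (cfg _ _)); lia.
Qed.

Lemma W_whr_step a b c s t1 t2 t (Q : state -> Prop) :
  s.1 b < s.1 a -> W c s t1 (fun s' => W (WhR a b c) s' t2 Q) ->
  (t1 + t2 + 2 <= t)%N -> W (WhR a b c) s t Q.
Proof.
move=> ab [u1 [s1 [ut1 [u2 [s2 [ut2 Qs st2]]] st1]]] tt.
exists (u1 + u2 + 2)%N, s2; split=> //; first by lia.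
move=> P p e; move: (e) => /= /(@embedded_cat (_ :: _))[/embedded_cons[P0 e1]] /=.
rewrite size_compile addnS => /embedded_cons[P1 _] f.
rewrite (_ : u1 + u2 + 2 + f = (u1 + (u2 + f).+1).+1)%N; last by lia.
by rewrite (run_jler _ _ P0) leNgt ab /= st1 // (run_jmp (q := p)) // st2.
Qed.

Lemma W_whn_step a b c s t1 t2 t (Q : state -> Prop) :
  (s.2 b < s.2 a)%N -> W c s t1 (fun s' => W (WhN a b c) s' t2 Q) ->
  (t1 + t2 + 2 <= t)%N -> W (WhN a b c) s t Q.
Proof.
move=> ab [u1 [s1 [ut1 [u2 [s2 [ut2 Qs st2]]] st1]]] tt.
exists (u1 + u2 + 2)%N, s2; split=> //; first by lia.
move=> P p e; move: (e) => /= /(@embedded_cat (_ :: _))[/embedded_cons[P0 e1]] /=.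
rewrite size_compile addnS => /embedded_cons[P1 _] f.
rewrite (_ : u1 + u2 + 2 + f = (u1 + (u2 + f).+1).+1)%N; last by lia.
by rewrite (run_jlen _ _ P0) leqNgt ab /= st1 // (run_jmp (q := p)) // st2.
Qed.

(** A round pays [tb] for the body and 2 for the test and the jump back; the final 1 is the test
    that leaves the loop. The invariant is indexed by a ghost counter, since the register driving
    the loop may be an address or a list link. *)
Lemma W_forr a b c (I : nat -> state -> Prop) k0 k1 tb t s (Q : state -> Prop) :
  (k0 <= k1)%N -> I k0 s ->
  (forall k s, (k0 <= k < k1)%N -> I k s ->
     s.1 b < s.1 a /\ W c s tb (I k.+1)) ->
  (forall s, I k1 s -> s.1 a <= s.1 b /\ Q s) ->
  ((k1 - k0) * (tb + 2) + 1 <= t)%N -> W (WhR a b c) s t Q.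
Proof.
move=> le01 I0 Ib Ie; have [d Ed] : exists d, (k1 = k0 + d)%N by exists (k1 - k0)%N; lia.
elim: d k0 t s le01 Ed I0 Ib => [|d IH] k0 t s le01 Ed I0 Ib Et.
  rewrite addn0 in Ed; rewrite -Ed in I0.
  by have [ab Qs] := Ie _ I0; apply: W_whr_exit => //; lia.
have [|ab Wc] := Ib k0 s _ I0; first by lia.
apply: (W_whr_step (t2 := (k1 - k0.+1) * (tb + 2) + 1) ab).
  apply: (W_impl Wc (leqnn _)) => s' Is'; apply: IH Is' _ _ => //; try lia.
  by move=> k s'' /andP[h1 h2]; apply: Ib; lia.
rewrite Ed in Et *; rewrite (_ : k0 + d.+1 - k0.+1 = d)%N; last by lia.
by move: Et; rewrite (_ : k0 + d.+1 - k0 = d.+1)%N ?mulSn; lia.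
Qed.

Lemma W_forn a b c (I : nat -> state -> Prop) k0 k1 tb t s (Q : state -> Prop) :
  (k0 <= k1)%N -> I k0 s ->
  (forall k s, (k0 <= k < k1)%N -> I k s ->
     (s.2 b < s.2 a)%N /\ W c s tb (I k.+1)) ->
  (forall s, I k1 s -> (s.2 a <= s.2 b)%N /\ Q s) ->
  ((k1 - k0) * (tb + 2) + 1 <= t)%N -> W (WhN a b c) s t Q.
Proof.
move=> le01 I0 Ib Ie; have [d Ed] : exists d, (k1 = k0 + d)%N by exists (k1 - k0)%N; lia.
elim: d k0 t s le01 Ed I0 Ib => [|d IH] k0 t s le01 Ed I0 Ib Et.
  rewrite addn0 in Ed; rewrite -Ed in I0.
  by have [ab Qs] := Ie _ I0; apply: W_whn_exit => //; lia.
have [|ab Wc] := Ib k0 s _ I0; first by lia.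
apply: (W_whn_step (t2 := (k1 - k0.+1) * (tb + 2) + 1) ab).
  apply: (W_impl Wc (leqnn _)) => s' Is'; apply: IH Is' _ _ => //; try lia.
  by move=> k s'' /andP[h1 h2]; apply: Ib; lia.
rewrite Ed in Et *; rewrite (_ : k0 + d.+1 - k0.+1 = d)%N; last by lia.
by move: Et; rewrite (_ : k0 + d.+1 - k0 = d.+1)%N ?mulSn; lia.
Qed.

Lemma W_cat c1 c2 s t t1 t2 (Q : state -> Prop) :
  W c1 s t1 (fun s1 => W c2 s1 t2 Q) -> (t1 + t2 <= t)%N -> W (Sq c1 c2) s t Q.
Proof. by move=> W1; apply: (W_seq W1). Qed.

Lemma W_blk_seq l c s t t1 (Q : state -> Prop) :
  all basic l -> W c (exec_blk l s) t1 Q -> (size l + t1 <= t)%N ->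
  W (Sq (Blk l) c) s t Q.
Proof. by move=> lb Wc; apply: W_cat; exact: W_blk. Qed.

Lemma W_blk_step i l s t (Q : state -> Prop) :
  basic i -> W (Blk l) (step i s) t Q -> W (Blk (i :: l)) s t.+1 Q.
Proof.
move=> ib [u [s' [ut Qs st]]]; exists u.+1, s'; split=> // P p /= /embedded_cons[Pi e] f.
by rewrite addSn (run_basic _ _ Pi) // st //= addnS.
Qed.

Lemma W_nil s t (Q : state -> Prop) : Q s -> W (Blk [::]) s t Q.
Proof. by move=> Qs; apply: W_blk. Qed.

End Logic.

Lemma upd_eq T (f : nat -> T) k v : upd f k v k = v.
Proof. by rewrite /upd eqxx. Qed.

Lemma upd_ne T (f : nat -> T) k v j : j != k -> upd f k v j = f j.
Proof. by rewrite /upd => /negPf ->. Qed.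

(** * Faces of the unit ball *)

(** The most significant digit comes first, so that Horner's rule [hv] rebuilds the number from left
    to right while digits are read off with decreasing powers of 3. *)
Definition dg (n u i : nat) : nat := (u %/ 3 ^ (n - i.+1)) %% 3.

Fixpoint hv (d : nat -> nat) (k : nat) : nat :=
  if k is k'.+1 then (hv d k' * 3 + d k')%N else 0%N.

Lemma hv_lt d k : (forall i, d i < 3)%N -> (hv d k < 3 ^ k)%N.
Proof.
move=> d3; elim: k => //= k IH; rewrite expnS; have := d3 k; lia.
Qed.

Lemma hv_div d n k : (forall i, d i < 3)%N -> (k <= n)%N ->
  (hv d n %/ 3 ^ (n - k) = hv d k)%N.
Proof.
move=> d3 kn; rewrite -{1}(subnK kn); elim: (n - k)%N => [|j IH].
  by rewrite expn0 divn1.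
by rewrite addSn /= expnS divnMA divnMDl // (divn_small (d3 _)) addn0.
Qed.

Lemma dg_hv d n i : (forall i, d i < 3)%N -> (i < n)%N -> dg n (hv d n) i = d i.
Proof. by move=> d3 ln; rewrite /dg hv_div //= modnMDl modn_small. Qed.

Section Faces.
Variables (R : realType) (n : nat).
Implicit Types (x y z : 'cV[R]_n) (B : 'M[R]_n).

Lemma pnorm_ge0 z : 0 <= pnorm z.
Proof. by rewrite divr_ge0 // bigmax_ge_id. Qed.

Lemma pnorm_leP z c : 0 <= c ->
  (pnorm z <= c) <-> (forall i j, z i ord0 - z j ord0 <= 2 * c).
Proof.
move=> c0; rewrite /pnorm ler_pdivrMr // mulrC; split=> [zc i j|zc].
  by apply: le_trans zc; apply: (bigmax_sup i) => //; exact: (bigmax_sup j).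
by apply: bigmax_le => [|i _]; [lra|apply: bigmax_le => [|j _]; [lra|exact: zc]].
Qed.

Lemma pnorm_ltP z c : 0 < c ->
  (pnorm z < c) <-> (forall i j, z i ord0 - z j ord0 < 2 * c).
Proof.
move=> c0; rewrite /pnorm ltr_pdivrMr // mulrC; split=> [zc i j|zc].
  apply: le_lt_trans zc; apply: (bigmax_sup i) => //.
  exact: (bigmax_sup j).
by apply: bigmax_lt => [|i _]; [lra|apply: bigmax_lt => [|j _]; [lra|exact: zc]].
Qed.

Lemma pnorm_pair z i j : z i ord0 - z j ord0 <= 2 * pnorm z.
Proof. exact: (pnorm_leP z (pnorm_ge0 z)).1. Qed.

Lemma pnorm_pair_norm z i j : `|z i ord0 - z j ord0| <= 2 * pnorm z.
Proof. by rewrite ler_norml lerNl opprB !pnorm_pair. Qed.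

Lemma pair_le2 z i j : pnorm z <= 1 -> z i ord0 - z j ord0 <= 2.
Proof. by move=> z1; have := pnorm_pair z i j; lra. Qed.

Definition dval (d : nat) : R := if d == 1%N then 1 else if d == 2 then -1 else 0.

Lemma dval_le d : -1 <= dval d <= 1.
Proof. by rewrite /dval; case: ifP => _; [|case: ifP => _]; lra. Qed.

Definition dvec (u : nat) : 'cV[R]_n := \col_i dval (dg n u i).

Lemma pnorm_dvec u : pnorm (dvec u) <= 1.
Proof.
apply/pnorm_leP => // i j; rewrite !mxE.
by have := dval_le (dg n u i); have := dval_le (dg n u j); lra.
Qed.

(** On the unit ball 2 is the largest possible difference; [hi] and [lo] mark the upper and lower
    members of tight pairs. *)
Definition hi z i := [exists j, z i ord0 - z j ord0 == 2].
Definition lo z i := [exists j, z j ord0 - z i ord0 == 2].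
Definition digit z i : nat := if hi z i then 1 else if lo z i then 2 else 0.
Definition dig z k : nat := if insub k is Some i then digit z i else 0.

(* The face of the unit ball that contains [z] in its relative interior. *)
Definition code z : nat := hv (dig z) n.

Lemma dig_lt3 z k : (dig z k < 3)%N.
Proof. by rewrite /dig /digit; case: insub => // i; case: ifP => //; case: ifP. Qed.

Lemma code_lt z : (code z < 3 ^ n)%N.
Proof. exact: hv_lt (dig_lt3 z). Qed.

Lemma dvec_code z i : dvec (code z) i ord0 = dval (digit z i).
Proof. by rewrite mxE dg_hv //; [rewrite /dig valK | exact: dig_lt3]. Qed.

Lemma hi_lo z i : pnorm z <= 1 -> hi z i -> lo z i = false.
Proof.
move=> z1 /existsP[j /eqP ij]; apply/existsP => -[k /eqP ki].
by have := pair_le2 k j z1; lra.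
Qed.

(** The canonical point has exactly the tight pairs of [z]. If i and j carry the digits 1 and 2,
    some l and k satisfy z_i - z_l = 2 and z_k - z_j = 2, and then z_k - z_l <= 2 forces z_i - z_j
    >= 2. *)
Lemma dvec_code_pair z i j : pnorm z <= 1 ->
  (dvec (code z) i ord0 - dvec (code z) j ord0 == 2) = (z i ord0 - z j ord0 == 2).
Proof.
move=> z1; rewrite !dvec_code; apply/eqP/eqP => [|zij]; last first.
  have hii : hi z i by apply/existsP; exists j; apply/eqP.
  have loj : lo z j by apply/existsP; exists i; apply/eqP.
  have hij : hi z j = false.
    by apply: contraTF loj => hij; rewrite (hi_lo z1 hij).
  by rewrite /digit hii hij loj /dval /=; lra.
move=> dd; have := dval_le (digit z i); have := dval_le (digit z j) => dj di.
have : dval (digit z i) = 1 by lra.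
have : dval (digit z j) = -1 by lra.
rewrite /digit; case: (boolP (hi z j)) => [_|_]; first by rewrite /dval /=; lra.
case: (boolP (lo z j)) => [|_]; last by rewrite /dval /=; lra.
move=> /existsP[k /eqP zk] _.
case: (boolP (hi z i)) => [|_]; last by case: ifP; rewrite /dval /=; lra.
move=> /existsP[l /eqP zl] _.
by have := pair_le2 k l z1; have := pair_le2 i j z1; lra.
Qed.

Lemma code_eq z z' :
  (forall i j, (z i ord0 - z j ord0 == 2) = (z' i ord0 - z' j ord0 == 2)) ->
  code z = code z'.
Proof.
move=> zz'; have dd k : dig z k = dig z' k.
  rewrite /dig; case: insub => // i; rewrite /digit.
  have -> : hi z i = hi z' i by apply: eq_existsb => j; exact: zz'.
  by have -> : lo z i = lo z' i by apply: eq_existsb => j; exact: zz'.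
by rewrite /code; elim: {1 2}n => //= k ->; rewrite dd.
Qed.

Lemma dvec0 : dvec 0 = 0.
Proof. by apply/colP => i; rewrite !mxE /dg div0n mod0n. Qed.

Lemma code0P z : pnorm z <= 1 -> (code z = 0%N) <-> (pnorm z < 1).
Proof.
move=> z1; rewrite pnorm_ltP // mulr1; split=> [c0 i j|zlt].
  rewrite lt_neqAle pair_le2 // andbT -dvec_code_pair // c0 dvec0 !mxE subr0.
  by rewrite eq_sym pnatr_eq0.
rewrite /code; elim: {1}n => //= k ->; rewrite /dig /digit.
case: insub => // i; case: ifP => [/existsP[j /eqP ij]|_]; first by have := zlt i j; rewrite ij ltxx.
by case: ifP => [/existsP[j /eqP ij]|//]; have := zlt j i; rewrite ij ltxx.
Qed.

Lemma admissible1 : admissible (1%:M : 'M[R]_n).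
Proof. by split=> [|x]; rewrite mul1mx. Qed.

Lemma admissibleM B B' : admissible B -> admissible B' -> admissible (B *m B').
Proof.
move=> [B1 Bc] [B'1 B'c]; split=> [|x]; first by rewrite -mulmxA B'1 B1.
by rewrite -mulmxA; exact: le_trans (Bc _) (B'c _).
Qed.

(** There are finitely many pairs, so those that are not tight miss 2 by a uniform margin. The seed
    1 caps the margin, which keeps the weight used in [face_image] below 1. *)
Lemma strict_gap x : pnorm x <= 1 -> exists d : R, [/\ 0 < d, d <= 1 &
  forall i j, x i ord0 - x j ord0 != 2 -> x i ord0 - x j ord0 <= 2 - d].
Proof.
move=> x1; pose P (p : 'I_n * 'I_n) := x p.1 ord0 - x p.2 ord0 != 2.
exists (\big[Num.min/1]_(p | P p) (2 - (x p.1 ord0 - x p.2 ord0))); split.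
- apply: lt_bigmin => // -[i j]; rewrite /P /= => ij.
  by have := pair_le2 i j x1; rewrite subr_gt0 lt_neqAle ij => ->.
- exact: bigmin_le_id.
- move=> i j ij; have := @bigmin_le_cond _ _ _ 1 (i, j) P
    (fun p => 2 - (x p.1 ord0 - x p.2 ord0)) ij.
  by rewrite /=; lra.
Qed.

(* [x] is interior to its face, hence a proper convex combination of [x'] and of another
   point of the ball. *)
Lemma face_image B x x' i j : admissible B -> pnorm x <= 1 -> pnorm x' <= 1 ->
  (forall k l, x k ord0 - x l ord0 = 2 -> x' k ord0 - x' l ord0 = 2) ->
  (B *m x) i ord0 - (B *m x) j ord0 = 2 ->
  (B *m x') i ord0 - (B *m x') j ord0 = 2.
Proof.
move=> [_ Bc] x1 x'1 xx' Bij; have [d [d0 d1 gap]] := strict_gap x1.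
(* With weight e = d / 4 the point u = (x - e x') / (1 - e) stays in the ball: a pair tight for x
   gives exactly 2, any other at most (2 - d + 2 e) / (1 - e) = 2. *)
have [e eE] : exists e : R, d = 4 * e by exists (d / 4); lra.
have e0 : 0 < e by lra.
have e1 : 0 < 1 - e by lra.
pose u := (1 - e)^-1 *: (x - e *: x').
have u1 : pnorm u <= 1.
  apply/pnorm_leP => // k l; rewrite !mxE -mulrBr mulrC ler_pdivrMr //.
  have [/eqP kl|kl] := boolP (x k ord0 - x l ord0 == 2).
    by have := congr1 ( *%R e) (xx' _ _ kl); lra.
  have := gap _ _ kl; have := ler_wpM2l (ltW e0) (pair_le2 l k x'1).
  by lra.
have xE : x = (1 - e) *: u + e *: x'.
  by rewrite scalerA divff ?scale1r ?subrK // gt_eqF.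
clearbody u.
have Bu := pair_le2 i j (le_trans (Bc u) u1).
have Bx' := pair_le2 i j (le_trans (Bc x') x'1).
move: Bij; rewrite xE mulmxDr -!scalemxAr.
move: (B *m u) (B *m x') Bu Bx' => v w; rewrite !mxE => Bu Bx' Bij.
suff : 2 <= w i ord0 - w j ord0 by lra.
by rewrite -(ler_pM2l e0); have := ler_wpM2l (ltW e1) Bu; lra.
Qed.

(** [z] and [dvec (code z)] have the same tight pairs, so [face_image] applies in both directions;
    hence the automaton can follow codes instead of vectors. *)
Lemma code_step B z : admissible B -> pnorm z <= 1 ->
  code (B *m z) = code (B *m dvec (code z)).
Proof.
move=> Ba z1; have d1 := pnorm_dvec (code z).
apply: code_eq => i j; apply/eqP/eqP; apply: face_image => // k l /eqP.
  by rewrite -dvec_code_pair // => /eqP.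
by rewrite dvec_code_pair // => /eqP.
Qed.

Lemma row_sum1 B i : B *m ones R n = ones R n -> \sum_j B i j = 1.
Proof.
move=> /colP/(_ i); rewrite !mxE => <-.
by apply: eq_bigr => j _; rewrite mxE mulr1.
Qed.

Lemma midpoint z (i0 : 'I_n) : exists c, forall i, `|z i ord0 - c| <= pnorm z.
Proof.
have [k _ kmax] := @arg_maxP _ _ _ i0 xpredT (fun i => z i ord0) isT.
exists (z k ord0 - pnorm z) => i; have := kmax i isT => /= ik.
by rewrite ler_norml; have := pnorm_pair z k i; lra.
Qed.

(* A linear functional on the cube is maximal at a vertex, and the vertices are [dvec u]. *)
Lemma contraction B (q : R) : B *m ones R n = ones R n -> 0 <= q ->
  (forall u, (u < 3 ^ n)%N -> pnorm (B *m dvec u) <= q) ->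
  forall z, pnorm (B *m z) <= q * pnorm z.
Proof.
move=> B1 q0 Bq z; apply/pnorm_leP => [|i j]; first by rewrite mulr_ge0 ?pnorm_ge0.
have [c zc] := midpoint z i.
pose C l := B i l - B j l.
have C0 : \sum_l C l = 0 by rewrite sumrB !row_sum1 // subrr.
have BE y : (B *m y) i ord0 - (B *m y) j ord0 = \sum_l C l * y l ord0.
  by rewrite !mxE -sumrB; apply: eq_bigr => l _; rewrite mulrBl.
(* The sign pattern of [C]: pairing [C] with this vertex of the cube gives its l1 norm, which is
   therefore at most 2 q. *)
pose d k := if insub k is Some l then (if (0 <= C l)%R then 1 else 2)%N else 0%N.
have d3 k : (d k < 3)%N by rewrite /d; case: insub => // l; case: ifP.
have := pnorm_pair (B *m dvec (hv d n)) i j; have := Bq _ (hv_lt n d3).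
rewrite BE; have -> : \sum_l C l * dvec (hv d n) l ord0 = \sum_l `|C l|.
  apply: eq_bigr => l _; rewrite mxE dg_hv // /d valK /dval.
  by case: (leP 0 (C l)) => Cl /=; [rewrite mulr1 ger0_norm | rewrite mulrN1 ltr0_norm].
move=> Bd Cd; have Cq : \sum_l `|C l| <= 2 * q by lra.
(* [C] sums to 0, so [z] may be recentred at [c], where its entries are bounded by [pnorm z]. *)
have -> : (B *m z) i ord0 - (B *m z) j ord0 = \sum_l C l * (z l ord0 - c).
  rewrite BE; under [RHS]eq_bigr do rewrite mulrBr.
  by rewrite sumrB -mulr_suml C0 mul0r subr0.
apply: le_trans (_ : \sum_l `|C l| * pnorm z <= _).
  apply: ler_sum => l _; apply: le_trans (ler_norm _) _.
  by rewrite normrM ler_wpM2l.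
by rewrite -mulr_suml (mulrA 2 q); exact: (ler_wpM2r (pnorm_ge0 z) Cq).
Qed.

End Faces.

(** * Convergence to consensus *)

Section Convergence.
Variables (R : realType) (n m : nat) (A : 'I_m -> 'M[R]_n).
Hypothesis Aadm : forall k, admissible (A k).

Lemma consensus_pnorm (x : nat -> 'cV[R]_n) : conv_to_consensus x ->
  exists t0, forall t, (t0 <= t)%N -> pnorm (x t) < 1.
Proof.
move=> [c xc]; have near_c (i : 'I_n) : exists t0, forall t, (t0 <= t)%N ->
    `|c - x t i ord0| < 1 / 2.
  have /cvgrPdist_lt/(_ (1 / 2))[|t0 _ tP] := xc i; first by lra.
  by exists t0 => t tt; exact: tP.
have [f fP] := choice near_c.
exists (\max_i f i)%N => t tt; apply/pnorm_ltP => // i j.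
have := fP i t (leq_trans (leq_bigmax _) tt).
have := fP j t (leq_trans (leq_bigmax _) tt).
by rewrite !ltr_norml; lra.
Qed.

Section Geometric.
Variables (sigma : nat -> 'I_m) (x0 : 'cV[R]_n) (L : nat) (q : R).
Hypotheses (L0 : (0 < L)%N) (q1 : q < 1).
Let x := traj A sigma x0.
Hypothesis xq : forall j, pnorm (x (j.+1 * L)) <= q * pnorm (x (j * L)).

Lemma pnorm_traj_le t s : pnorm (x (t + s)) <= pnorm (x t).
Proof.
elim: s => [|s IH]; first by rewrite addn0.
by rewrite addnS; apply: le_trans IH; exact: (Aadm _).2.
Qed.

(** Inside a block the seminorm is at most its initial value, and 1 - q times that value is at most
    the drop over the block; the drops telescope. *)
Lemma sum_pnorm_blocks j :
  (1 - q) * \sum_(t < j * L) pnorm (x t) <=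
  L%:R * (pnorm (x 0) - pnorm (x (j * L))).
Proof.
elim: j => [|j IH]; first by rewrite mul0n big_ord0 subrr !mulr0.
have q10 : 0 <= 1 - q by rewrite subr_ge0 ltW.
rewrite mulSn addnC big_split_ord /= mulrDr.
have block : \sum_(i < L) pnorm (x (j * L + i)) <= L%:R * pnorm (x (j * L)).
  rewrite -[X in X%:R]card_ord mulr_natl -sumr_const.
  by apply: ler_sum => i _; exact: pnorm_traj_le.
have := ler_wpM2l q10 block; have := xq j; rewrite mulSn addnC.
have : 0 <= L%:R :> R by [].
by move=> L0' /(ler_wpM2l L0'); lra.
Qed.

Lemma sum_pnorm_bounded N :
  \sum_(0 <= t < N) pnorm (x t) <= L%:R * pnorm (x 0) / (1 - q).
Proof.
have q10 : 0 < 1 - q by rewrite subr_gt0.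
rewrite ler_pdivlMr //.
rewrite mulrC; apply: (le_trans (y := (1 - q) * \sum_(t < N * L) pnorm (x t))).
  apply: ler_wpM2l; first exact: ltW.
  rewrite -(big_mkord xpredT (fun t => pnorm (x t))).
  have NL : (N <= N * L)%N by rewrite leq_pmulr.
  rewrite (big_cat_nat (leq0n N) NL) /= lerDl.
  by apply: sumr_ge0 => t _; exact: pnorm_ge0.
apply: le_trans (sum_pnorm_blocks N) _; apply: ler_wpM2l => //.
by rewrite gerBl pnorm_ge0.
Qed.

(* The matrices need not be nonnegative, so a decay of [pnorm] alone does not bound the
   trajectory; but each step moves a coordinate by at most a multiple of [pnorm (x t)]. *)
Lemma coord_step (i : 'I_n) : exists K, 0 <= K /\
  forall t, `|x t.+1 i ord0 - x t i ord0| <= K * pnorm (x t).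
Proof.
exists (2 * \sum_k \sum_l `|A k i l|); split.
  by rewrite mulr_ge0 // sumr_ge0 // => k _; exact: sumr_ge0.
move=> t; rewrite [x t.+1]/= -/x mxE.
(* Rows sum to 1, so x_i can be subtracted from every entry; only differences remain, which the
   seminorm controls. *)
have -> : \sum_l A (sigma t) i l * x t l ord0 - x t i ord0 =
    \sum_l A (sigma t) i l * (x t l ord0 - x t i ord0).
  under [RHS]eq_bigr do rewrite mulrBr.
  by rewrite sumrB -mulr_suml (row_sum1 _ (Aadm _).1) mul1r.
apply: le_trans (ler_norm_sum _ _ _) _.
apply: (le_trans (y := \sum_l `|A (sigma t) i l| * (2 * pnorm (x t)))).
  by apply: ler_sum => l _; rewrite normrM ler_wpM2l // pnorm_pair_norm.
rewrite -mulr_suml mulrCA mulrA; apply: ler_wpM2r; first exact: pnorm_ge0.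
apply: ler_wpM2l => //; rewrite (bigD1 (sigma t)) //= lerDl.
by apply: sumr_ge0 => k _; exact: sumr_ge0.
Qed.

Lemma geometric_consensus : (0 < n)%N -> conv_to_consensus x.
Proof.
move=> n0; pose i0 := Ordinal n0.
pose D t := pnorm (x t); pose S := series D.
have D0 t : 0 <= D t by exact: pnorm_ge0.
have SE N : S N = \sum_(0 <= t < N) D t by [].
have Snd : nondecreasing_seq S.
  by apply/nondecreasing_seqP => N; rewrite !SE big_nat_recr //= lerDl.
have Scvg : cvgn S.
  apply: nondecreasing_is_cvgn => //.
  by exists (L%:R * pnorm (x 0) / (1 - q)) => _ [N _ <-]; exact: sum_pnorm_bounded.
have Dcvg : D @ \oo --> 0 by exact: cvg_series_cvg_0.
have [K [K0 aK]] := coord_step i0.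
pose a t : R := x t i0 ord0.
have aS t : `|a t - a 0| <= K * S t.
  elim: t => [|t IH]; first by rewrite subrr normr0 SE big_geq // mulr0.
  rewrite SE big_nat_recr //= -SE mulrDr.
  have -> : a t.+1 - a 0 = (a t - a 0) + (a t.+1 - a t) by lra.
  by apply: le_trans (ler_normD _ _) _; apply: lerD => //; exact: aK.
(* The added term outweighs any decrease of [a], so [b] is monotone; it is bounded because [S] is,
   and thus [a], the difference of two convergent sequences, converges. *)
pose b t : R := a t + K * S t.
have bcvg : cvgn b.
  apply: nondecreasing_is_cvgn.
    apply/nondecreasing_seqP => t; rewrite /b !SE big_nat_recr //= mulrDr.
    by have := aK t; rewrite ler_norml -/(a t) -/(a t.+1) -/(D t); lra.
  exists (a 0 + 2 * (K * (L%:R * pnorm (x 0) / (1 - q)))) => _ [t _ <-].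
  have := aS t; have := ler_wpM2l K0 (sum_pnorm_bounded t); rewrite -SE /b.
  by rewrite ler_norml; lra.
have acvg : a @ \oo --> limn b - K * limn S.
  have -> : a = b - (fun t => K * S t).
    by apply/funext => t; rewrite /b fctE addrK.
  apply: cvgB => //; apply: cvgMr => //.
(* The other coordinates share the limit of coordinate [i0] because [D] tends to 0. *)
exists (limn b - K * limn S) => i; apply/cvgrPdist_lt => e e0.
have e4 : 0 < e / 4 by lra.
move/cvgrPdist_lt/(_ _ e4): acvg => [t1 _ t1P].
move/cvgrPdist_lt/(_ _ e4): Dcvg => [t2 _ t2P].
exists (maxn t1 t2) => // t /=; rewrite geq_max => /andP[tt1 tt2].
have := t1P t tt1; have := t2P t tt2; rewrite /= sub0r normrN (ger0_norm (D0 t)).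
have := pnorm_pair_norm (x t) i i0; rewrite -/(D t) -/(a t).
by rewrite ler_norml !ltr_norml; lra.
Qed.

End Geometric.
End Convergence.

(** * Paths in the face graph *)

Section Peeling.
Variables (R : realType) (n m : nat) (A : 'I_m -> 'M[R]_n).
Hypothesis Aadm : forall k, admissible (A k).

Definition succ (k : 'I_m) (u : nat) : nat := code (A k *m dvec R n u).

Fixpoint wprod (w : seq 'I_m) : 'M[R]_n :=
  if w is k :: w' then wprod w' *m A k else 1%:M.

Definition wsucc (u : nat) (w : seq 'I_m) : nat := foldl (fun u k => succ k u) u w.

Lemma wprod_adm w : admissible (wprod w).
Proof. by elim: w => [|k w IH] /=; [exact: admissible1 | exact: admissibleM]. Qed.

Lemma code_wprod w (z : 'cV[R]_n) : pnorm z <= 1 ->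
  code (wprod w *m z) = wsucc (code z) w.
Proof.
elim: w z => [|k w IH] z z1 /=; first by rewrite mul1mx.
rewrite -mulmxA IH; last exact: le_trans ((Aadm k).2 _) z1.
by rewrite /wsucc /= /succ -code_step.
Qed.

(** When [u] is not the code of a face, [code (dvec u)] differs from [u]. After one letter the two
    sides agree, since [succ] is itself computed from [dvec u]. *)
Lemma code_wprod_dvec w u : (0 < size w)%N ->
  code (wprod w *m dvec R n u) = wsucc u w.
Proof.
case: w => // k w _ /=; rewrite -mulmxA code_wprod //.
exact: le_trans ((Aadm k).2 _) (pnorm_dvec R n u).
Qed.

Lemma succ_lt k u : (succ k u < 3 ^ n)%N.
Proof. exact: code_lt. Qed.

Lemma wsucc_lt u w : (u < 3 ^ n)%N -> (wsucc u w < 3 ^ n)%N.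
Proof. by elim: w u => //= k w IH u _; apply: IH; exact: succ_lt. Qed.

Lemma succ0 k : succ k 0 = 0%N.
Proof.
have p0 : pnorm (0 : 'cV[R]_n) < 1.
  by apply/pnorm_ltP => // i j; rewrite !mxE; lra.
by rewrite /succ dvec0 mulmx0; apply/code0P => //; exact: ltW.
Qed.

Lemma wsucc0 w : wsucc 0 w = 0%N.
Proof. by elim: w => //= k w; rewrite /wsucc /= succ0. Qed.

Lemma traj_wprod sigma x0 t L : traj A sigma x0 (t + L) =
  wprod [seq sigma i | i <- iota t L] *m traj A sigma x0 t.
Proof.
elim: L t => [|L IH] t /=; first by rewrite addn0 mul1mx.
by rewrite -addSnnS IH /= mulmxA.
Qed.

(** Code 0 means lying in the open ball; the maximum of finitely many seminorms below 1 is below 1,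
    and [contraction] extends it to all vectors. *)
Lemma word_contraction w : (0 < size w)%N ->
  (forall u, (u < 3 ^ n)%N -> wsucc u w = 0%N) ->
  exists q, [/\ 0 <= q, q < 1 & forall z, pnorm (wprod w *m z) <= q * pnorm z].
Proof.
move=> w0 wz; pose f (u : 'I_(3 ^ n)) := pnorm (wprod w *m dvec R n u).
exists (\big[Num.max/0]_u f u); split; first exact: bigmax_ge_id.
- apply: bigmax_lt => // u _; apply/code0P.
    exact: le_trans ((wprod_adm w).2 _) (pnorm_dvec R n u).
  by rewrite code_wprod_dvec // wz.
- apply: contraction; [exact: (wprod_adm w).1 | exact: bigmax_ge_id|].
  by move=> u lu; exact: (le_bigmax 0 f (Ordinal lu)).
Qed.

(** A nonzero code keeps the seminorm at 1, whereas consensus would eventually bring it below 1. *)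
Lemma dvec_not_consensus sigma v :
  (forall t, wsucc v [seq sigma i | i <- iota 0 t.+1] != 0%N) ->
  ~ conv_to_consensus (traj A sigma (dvec R n v)).
Proof.
move=> nz /consensus_pnorm[t0 /(_ t0.+1 (leqnSn _)) lt1].
have := nz t0; rewrite -code_wprod_dvec ?size_map //.
have := traj_wprod sigma (dvec R n v) 0 t0.+1; rewrite add0n [traj _ _ _ 0]/= => <-.
by move/negP; apply; apply/eqP/code0P => //; exact: ltW.
Qed.

Variable q : seq nat.
Hypotheses (q_uniq : uniq (0%N :: q))
  (q_lt : forall v, v \in 0%N :: q -> (v < 3 ^ n)%N).
Let Q := 0%N :: q.

(** Along a path the position in [Q] drops at each letter, so every word of length [size Q] ends in
    0. Conversely, a path that stays outside [Q] forever spells out a switching sequence without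
    consensus. *)
Lemma problem1P :
  (forall v, v \in Q -> v != 0%N -> forall k, (index (succ k v) Q < index v Q)%N) ->
  (forall v, (v < 3 ^ n)%N -> v \notin Q -> exists k, succ k v \notin Q) ->
  (0 < n)%N ->
  (forall v, (v < 3 ^ n)%N -> v \in Q) <-> problem1 A.
Proof.
move=> rank clos n0; split=> [all_in x0 sigma|p1 v vlt].
- have idx w u : u \in Q -> (index (wsucc u w) Q <= index u Q - size w)%N.
    elim: w u => [|k w IH] u uQ; first by rewrite subn0.
    have [->|u0] := eqVneq u 0%N; first by rewrite wsucc0.
    rewrite [wsucc u _]/(wsucc (succ k u) w) [size _]/=; apply: leq_trans (IH _ (all_in _ (succ_lt k u))) _.
    by have := rank u uQ u0 k; lia.
  have kill (w : (size Q).-tuple 'I_m) u : (u < 3 ^ n)%N -> wsucc u w = 0%N.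
    move=> ult; have := idx w u (all_in u ult); have := index_size u Q.
    rewrite size_tuple -subn_eq0 => /eqP ->; rewrite leqn0 /Q /=.
    by case: (eqVneq 0%N (wsucc u w)).
  (* Words of this length are finite in number, so one factor below 1 serves every block of
     [sigma]. *)
  have /choice[c cP] (w : (size Q).-tuple 'I_m) : exists c,
      [/\ 0 <= c, c < 1 & forall z, pnorm (wprod w *m z) <= c * pnorm z].
    by apply: word_contraction; [rewrite size_tuple | exact: kill].
  apply: (@geometric_consensus _ _ _ _ Aadm sigma x0 (size Q)
    (\big[Num.max/0]_w c w)) => //.
    by apply: bigmax_lt => // w _; case: (cP w).
  move=> j; rewrite mulSn addnC traj_wprod.
  have sw : size [seq sigma i | i <- iota (j * size Q) (size Q)] == size Q.
    by rewrite size_map size_iota.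
  have [_ _ cw] := cP (Tuple sw); apply: le_trans (cw _) _.
  by apply: ler_wpM2r; [exact: pnorm_ge0 | exact: le_bigmax].
- apply/negPn/negP => vQ.
  have [k0 _] := clos v vlt vQ.
  have /choice[f fP] u : exists k, (u < 3 ^ n)%N -> u \notin Q -> succ k u \notin Q.
    have [/andP[u1 u2]|] := boolP ((u < 3 ^ n)%N && (u \notin Q)).
      by have [k kP] := clos u u1 u2; exists k.
    by rewrite negb_and => h; exists k0 => u1 u2; rewrite u1 u2 in h.
  pose us t := iter t (fun u => succ (f u) u) v.
  have usP t : (us t < 3 ^ n)%N /\ us t \notin Q.
    by elim: t => //= t [u1 u2]; split; [exact: succ_lt | exact: fP].
  apply: (@dvec_not_consensus (f \o us) v) (p1 _ _) => t.
  have -> : wsucc v [seq (f \o us) i | i <- iota 0 t.+1] = us t.+1.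
    elim: t.+1 => // s IH; rewrite -addn1 iotaD map_cat /wsucc foldl_cat /=.
    by rewrite -/(wsucc _ _) IH addn1.
  by have [_] := usP t.+1; apply: contraNneq => ->; rewrite mem_head.
Qed.

Lemma problem2P :
  (forall v, v \in Q -> v != 0%N -> exists k, (index (succ k v) Q < index v Q)%N) ->
  (forall v, (v < 3 ^ n)%N -> v \notin Q -> forall k, succ k v \notin Q) ->
  (0 < n)%N -> (0 < m)%N ->
  (forall v, (v < 3 ^ n)%N -> v \in Q) <-> problem2 A.
Proof.
move=> rank clos n0 m0; split=> [all_in|[sigma sP] v vlt].
- have kill1 u : u \in Q -> exists w, wsucc u w = 0%N.
    have [d] := ubnP (index u Q); elim: d u => // d IH u ud uQ.
    have [->|u0] := eqVneq u 0%N; first by exists [::].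
    have [k kP] := rank u uQ u0.
    have [|w wP] := IH (succ k u) _ (all_in _ (succ_lt k u)); first by lia.
    by exists (k :: w).
  (* Once [w] kills [l], append a word killing the place to which [w] has moved the next vertex [u];
     the sink absorbs the others. *)
  have kill (l : seq nat) : {subset l <= Q} -> exists w, forall u, u \in l -> wsucc u w = 0%N.
    elim: l => [|u l IH] lQ; first by exists [::].
    have [|w wP] := IH; first by move=> v vl; apply: lQ; rewrite inE vl orbT.
    have [|w' w'P] := kill1 (wsucc u w).
      by apply/all_in/wsucc_lt/q_lt/lQ; rewrite mem_head.
    exists (w ++ w') => v; have -> : wsucc v (w ++ w') = wsucc (wsucc v w) w'.
      exact: foldl_cat.
    by rewrite inE => /orP[/eqP->//|/wP ->]; rewrite wsucc0.
  have [w wP] := kill Q (fun _ => id).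
  (* The extra letter makes the word nonempty, as periodic repetition and [word_contraction]
     require. *)
  pose k0 := Ordinal m0; pose w1 := rcons w k0.
  have w1P u : (u < 3 ^ n)%N -> wsucc u w1 = 0%N.
    move=> /all_in/wP; rewrite /w1 -cats1 /wsucc foldl_cat /= => ->.
    exact: succ0.
  have w10 : (0 < size w1)%N by rewrite size_rcons.
  have [c [c0 c1 cP]] := word_contraction w10 w1P.
  exists (fun t => nth k0 w1 (t %% size w1)) => x0.
  apply: (geometric_consensus Aadm w10 c1 _ n0) => j.
  rewrite mulSn addnC traj_wprod.
  have -> : [seq nth k0 w1 (i %% size w1) | i <- iota (j * size w1) (size w1)] = w1.
    rewrite -[X in iota X]addn0 iotaDl -map_comp -[RHS](mkseq_nth k0).
    apply/eq_in_map => i; rewrite mem_iota /= add0n => il.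
    by rewrite modnMDl modn_small.
  exact: cP.
- apply/negPn/negP => vQ; apply: (@dvec_not_consensus sigma v) (sP _) => t.
  have notQ w u : (u < 3 ^ n)%N -> u \notin Q -> wsucc u w \notin Q.
    by elim: w u => //= k w IH u u1 u2; apply: IH; [exact: succ_lt | exact: clos].
  have := notQ [seq sigma i | i <- iota 0 t.+1] v vlt vQ.
  by apply: contraNneq => ->; rewrite mem_head.
Qed.

End Peeling.

(** * The program and its verification *)

Definition save_registers (j k : nat) : program :=
  flatten [seq [:: RStore 14 i; NAdd 14 14 3] | i <- iota j k].

(* The input occupies the real registers that the program needs as scratch space, so the
   first 16 cells are first saved through constant register numbers and the rest of the
   matrices is then copied behind them. *)
Definition setup : cmd :=
  Sq (Blk [:: NConst 3 1])
 (Sq (WhN 0 14 (Blk [:: NAdd 4 4 0; NAdd 14 14 3]))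
 (Sq (Blk [:: NConst 14 0])
 (Sq (WhN 1 14 (Blk [:: NAdd 5 5 4; NAdd 14 14 3]))
 (Sq (Blk [:: NConst 15 16; NAdd 7 5 15; NAdd 14 7 2])
 (Sq (Blk (save_registers 0 16))
 (Sq (WhN 5 15 (Blk [:: RLoad 0 15; RStore 14 0; NAdd 14 14 3; NAdd 15 15 3]))
 (Sq (Blk [:: RConst 0 0; RConst 1 1; RConst 2 2; RConst 3 3; RConst 4 1; NConst 6 1;
              NConst 14 0])
 (Sq (WhN 0 14 (Blk [:: NAdd 15 6 6; NAdd 6 15 6; RMul 4 4 3; NAdd 14 14 3]))
     (Blk [:: NConst 15 16; NAdd 8 7 5; NAdd 8 8 15; NAdd 9 8 0; NAdd 10 9 0;
              NAdd 11 10 6; NAdd 12 11 6; NAdd 13 12 6]))))))))).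

(** The remainder in real register 5 is below three times the new power in register 6, so at most
    two subtractions give the digit. Index registers cannot multiply: tripling is done by additions,
    and the multiple by 3 ^ n is built by its own Horner scheme. *)
Definition decode_digit : cmd :=
  Sq (Blk [:: RDiv 6 6 3; NAdd 17 15 15; NAdd 15 17 15; NAdd 17 16 16;
              NAdd 16 17 16; RStore 14 0])
 (Sq (IfR 6 5
       (Sq (Blk [:: RSub 5 5 6; NAdd 15 15 3; NAdd 16 16 6; RStore 14 1])
           (IfR 6 5 (Blk [:: RSub 5 5 6; NAdd 15 15 3; NAdd 16 16 6; RSub 7 0 1;
                            RStore 14 7])
                    (Blk [::])))
       (Blk [::]))
     (Blk [:: NAdd 14 14 3])).

(* Reads a vertex from real register 5; writes its digits, as entries 0, 1, -1, to the
   area [xb], the vertex itself to index register 15 and its [3 ^ n] multiple to 16. *)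
Definition decode : cmd :=
  Sq (Blk [:: RAdd 6 4 0; NAdd 14 8 2; NConst 15 0; NConst 16 0])
     (WhN 9 14 decode_digit).

(** Frame condition: [P] describes the addresses that are guaranteed untouched. *)
Definition keeps U (P : nat -> Prop) (f f' : nat -> U) := forall a, P a -> f' a = f a.

Lemma keeps_trans U (P P' : nat -> Prop) (f g h : nat -> U) :
  keeps P f g -> keeps P' g h -> (forall a, P a -> P' a) -> keeps P f h.
Proof. by move=> fg gh PP' a Pa; rewrite gh ?fg //; exact: PP'. Qed.

Lemma keeps_sub U (P P' : nat -> Prop) (f g : nat -> U) :
  keeps P f g -> (forall a, P' a -> P a) -> keeps P' f g.
Proof. by move=> fg PP' a /PP'; exact: fg. Qed.

Lemma keeps_refl U P (f : nat -> U) : keeps P f f.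
Proof. by []. Qed.

Lemma keeps_upd U (P : nat -> Prop) (f g : nat -> U) k v :
  keeps P f g -> ~ P k -> keeps P f (upd g k v).
Proof. by move=> fg nP a Pa; rewrite upd_ne ?fg //; apply/eqP => ak; rewrite ak in Pa. Qed.

Lemma div_digit u p : (0 < p)%N ->
  (u %/ p = 3 * (u %/ (3 * p)) + u %% (3 * p) %/ p)%N /\
  (u %% p = u %% (3 * p) - u %% (3 * p) %/ p * p)%N.
Proof.
move=> p0; have E := divn_eq u (3 * p); have E' := divn_eq (u %% (3 * p)) p.
have -> : (u %/ p = 3 * (u %/ (3 * p)) + u %% (3 * p) %/ p)%N.
  by rewrite {1}E mulnA divnMDl // [(_ * 3)%N]mulnC.
by split=> //; rewrite {1}E mulnA modnMDl; lia.
Qed.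

Definition edge_row : cmd :=
  Sq (Blk [:: RAdd 5 0 0; NAdd 14 8 2])
 (Sq (WhN 9 14 (Blk [:: RLoad 6 20; RLoad 7 14; RMul 6 6 7; RAdd 5 5 6;
                        NAdd 20 20 3; NAdd 14 14 3]))
     (Blk [:: RStore 19 5; NAdd 19 19 3])).

Definition edge_mul : cmd := Sq (Blk [:: NAdd 19 9 2]) (WhN 10 19 edge_row).

Definition edge_range : cmd :=
  Sq (Blk [:: RLoad 8 9; RLoad 9 9; NAdd 19 9 2])
     (WhN 10 19
       (Sq (Blk [:: RLoad 5 19])
       (Sq (IfR 5 8 (Blk [::]) (Blk [:: RAdd 8 5 0]))
       (Sq (IfR 9 5 (Blk [::]) (Blk [:: RAdd 9 5 0]))
           (Blk [:: NAdd 19 19 3]))))).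

Definition edge_code : cmd :=
  Sq (Blk [:: RSub 5 8 9; NAdd 19 9 2; NConst 21 0])
     (IfR 2 5
       (WhN 10 19
         (Sq (Blk [:: RLoad 5 19; NAdd 17 21 21; NAdd 21 17 21])
         (Sq (IfR 8 5 (Blk [:: NAdd 21 21 3])
             (IfR 5 9 (Blk [:: NAdd 21 21 3; NAdd 21 21 3]) (Blk [::])))
             (Blk [:: NAdd 19 19 3]))))
       (Blk [::])).

(* Multiplies the area [xb] by the matrix at index register 20, which moves on to the next
   matrix, and leaves the face of the product in index register 21. *)
Definition edge : cmd := Sq edge_mul (Sq edge_range edge_code).

Lemma sum_ord_lt_recr (V : nmodType) n (j : 'I_n) (F : 'I_n -> V) :
  \sum_(l < n | (l < j.+1)%N) F l = \sum_(l < n | (l < j)%N) F l + F j.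
Proof.
rewrite (bigD1 j) //= addrC; congr (_ + _); apply: eq_bigl => l.
by rewrite ltnS [RHS]ltn_neqAle andbC.
Qed.

(** Once the spread reaches 2, a tight pair joins a maximal to a minimal coordinate; comparing with
    the two extremes replaces the search over all pairs. *)
Lemma digit_range (R : realType) n (y : 'cV[R]_n) (a b i : 'I_n) : pnorm y <= 1 ->
  (forall i, y i ord0 <= y a ord0) -> (forall i, y b ord0 <= y i ord0) ->
  2 <= y a ord0 - y b ord0 ->
  digit y i = if y a ord0 <= y i ord0 then 1%N else
              if y i ord0 <= y b ord0 then 2%N else 0%N.
Proof.
move=> y1 ya yb yab; rewrite /digit; have yab' := pair_le2 a b y1.
have -> : hi y i = (y a ord0 <= y i ord0).
  apply/existsP/idP => [[j /eqP ij]|ai]; first by have := yb j; lra.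
  by exists b; apply/eqP; have := ya i; lra.
have -> // : lo y i = (y i ord0 <= y b ord0).
apply/existsP/idP => [[j /eqP ij]|ai]; first by have := ya j; lra.
by exists a; apply/eqP; have := yb i; lra.
Qed.

(* Linked lists of sources, as stored in memory: a list is encoded by the successor of its
   head (0 if empty); the cell of [v] is 0 if [v] is absent and otherwise the successor of
   the encoding of the rest of the list. *)
Definition enc (l : seq nat) : nat := if l is v :: _ then v.+1 else 0%N.

Definition nx (l : seq nat) (v : nat) : nat :=
  if v \in l then (enc (drop (index v l).+1 l)).+1 else 0%N.

Lemma nx_cons l v u : nx (v :: l) u = if u == v then (enc l).+1 else nx l u.
Proof.
by rewrite /nx in_cons /= [v == u]eq_sym; case: eqVneq => _ //=; rewrite drop0.
Qed.

Lemma nx_cat l1 l2 v : v \notin l1 -> nx (l1 ++ v :: l2) v = (enc l2).+1.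
Proof.
elim: l1 => [_|u l1 IH]; first by rewrite nx_cons eqxx.
by rewrite in_cons negb_or cat_cons nx_cons => /andP[/negPf -> /IH].
Qed.

Lemma pair_addr_inj T v w v' w' : (w < T)%N -> (w' < T)%N ->
  (v * T + w = v' * T + w')%N -> v = v' /\ w = w'.
Proof.
move=> wT w'T E; have T0 : (0 < T)%N by lia.
have := congr1 (divn^~ T) E; rewrite /= !divnMDl // !divn_small // !addn0 => vv.
by split=> //; move: E; rewrite vv => /addnI.
Qed.

(** [L w] lists the sources of edges into [w], so this is the number of distinct out-neighbours of
    [v]. *)
Definition deg T (L : nat -> seq nat) (v : nat) : nat := \sum_(w < T) (v \in L w).

Definition sources_total T (L : nat -> seq nat) : nat := \sum_(w < T) size (L w).

Lemma deg_insert T L v w v' : (w < T)%N -> v \notin L w ->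
  deg T (upd L w (v :: L w)) v' = (deg T L v' + (v' == v))%N.
Proof.
move=> wT vL; rewrite /deg (bigD1 (Ordinal wT)) //= [in RHS](bigD1 (Ordinal wT)) //=.
rewrite upd_eq in_cons addnAC; congr addn.
  by case: eqVneq => //= [->|_]; rewrite ?(negPf vL) ?addn0.
by apply: eq_bigr => i iw; rewrite upd_ne.
Qed.

Lemma sources_total_insert T L v w : (w < T)%N ->
  sources_total T (upd L w (v :: L w)) = (sources_total T L).+1.
Proof.
move=> wT; rewrite /sources_total (bigD1 (Ordinal wT)) //= [in RHS](bigD1 (Ordinal wT)) //=.
rewrite upd_eq /= addSn; congr (_ + _).+1.
by apply: eq_bigr => i iw; rewrite upd_ne.
Qed.

Definition build_insert (all : bool) : cmd :=
  Blk [:: NAdd 14 10 21; RLoad 11 14; RAdd 11 11 1; RStore 23 11; RAdd 11 10 1;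
          RStore 14 11; NAdd 14 11 15; RLoad 11 14;
          RAdd 11 (if all then 11 else 0) 1; RStore 14 11].

(** A nonzero table cell reveals a parallel edge, which is skipped so that counters refer to
    distinct out-neighbours. *)
Definition build_edge (all : bool) : cmd :=
  Sq edge
 (Sq (Blk [:: NAdd 23 13 16; NAdd 23 23 21; RLoad 11 23; NAdd 22 22 3])
     (IfR 11 0 (build_insert all) (Blk [::]))).

Definition build_vertex (all : bool) : cmd :=
  Sq (Blk [:: RAdd 5 10 0])
 (Sq decode
 (Sq (Blk [:: NAdd 20 7 2; NConst 22 0])
 (Sq (WhN 1 22 (build_edge all))
     (Blk [:: RAdd 10 10 1])))).

Definition build (all : bool) : cmd :=
  Sq (Blk [:: RAdd 10 1 0]) (WhR 4 10 (build_vertex all)).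

(** Links are stored as successors, hence the subtractions of 1. A vertex is queued exactly when its
    counter hits 0; the double inequality prevents a second entry when the counter turns negative,
    as happens in problem 2. *)
Definition traverse_edge : cmd :=
  Sq (Blk [:: RSub 12 10 1; RAdd 5 12 0])
 (Sq decode
 (Sq (Blk [:: NAdd 14 11 15; RLoad 11 14; RSub 11 11 1; RStore 14 11; NAdd 14 13 16;
              NAdd 14 14 26; RLoad 10 14; RSub 10 10 1])
     (IfR 11 0 (IfR 0 11 (Blk [:: RStore 25 12; NAdd 25 25 3]) (Blk [::]))
               (Blk [::])))).

Definition traverse_vertex : cmd :=
  Sq (Blk [:: RLoad 5 24; NAdd 24 24 3])
 (Sq decode
 (Sq (Blk [:: NAdd 26 15 2; NAdd 14 10 15; RLoad 10 14])
     (WhR 10 0 traverse_edge))).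

Definition traverse : cmd :=
  Sq (Blk [:: NAdd 24 12 2; NAdd 25 12 3]) (WhN 25 24 traverse_vertex).

Definition main (all : bool) : cmd :=
  Sq setup (Sq (build all) (Sq traverse (Blk [:: NAdd 14 12 6]))).

(* [decider true] decides problem 1 and [decider false] problem 2. *)
Definition decider (all : bool) : program :=
  compile (main all) 0 ++
  [:: JLeN 14 25 (csize (main all)).+2; Halt false; Halt true].

(* Number of out-neighbours that must be peeled before a vertex of out-degree [d] is. *)
Definition threshold (all : bool) (d : nat) : nat := if all then d else (0 < d)%N.

Section Routines.
Variables (R : realType) (n m : nat) (A : 'I_m -> 'M[R]_n).
(* Memory areas: matrices [Ab], vector [xb], its image [yb], list heads [hb], counters [cb],
   queue [qb], list cells [nb]. *)
Variables T Ab xb yb hb cb qb nb : nat.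
Hypotheses (TE : T = (3 ^ n)%N) (AbE : Ab = (m * n * n + 16)%N)
  (xbE : xb = (Ab + (m * n * n + 16))%N) (ybE : yb = (xb + n)%N)
  (hbE : hb = (yb + n)%N) (cbE : cb = (hb + T)%N) (qbE : qb = (cb + T)%N)
  (nbE : nb = (qb + T)%N).

Lemma xb_ge : (32 <= xb)%N /\ (Ab + m * n * n <= xb)%N.
Proof. by rewrite xbE AbE; split; lia. Qed.

(** The number 3 ^ n is also kept in real register 4: it is the first power used by [decode] and the
    bound of the vertex loop, whose variable is real. *)
Record static (s : state R) : Prop := Static {
  st_n : s.2 0 = n; st_m : s.2 1 = m; st_z : s.2 2 = 0%N; st_o : s.2 3 = 1%N;
  st_T : s.2 6 = T; st_Ab : s.2 7 = Ab; st_xb : s.2 8 = xb; st_yb : s.2 9 = yb;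
  st_hb : s.2 10 = hb; st_cb : s.2 11 = cb; st_qb : s.2 12 = qb; st_nb : s.2 13 = nb;
  st_0 : s.1 0%N = 0; st_1 : s.1 1%N = 1; st_2 : s.1 2 = 2; st_3 : s.1 3 = 3;
  st_TR : s.1 4 = T%:R;
  st_mat : forall (k : 'I_m) (i j : 'I_n), s.1 (Ab + (k * n * n + i * n + j))%N = A k i j }.

Lemma mat_index_lt (k : 'I_m) (i j : 'I_n) : (k * n * n + i * n + j < m * n * n)%N.
Proof.
have := ltn_ord k; have := ltn_ord i; have := ltn_ord j => jn iN km.
have : (k * n * n + n * n <= m * n * n)%N by rewrite -!mulnA -mulSnr leq_mul2r km orbT.
have : (i * n + n <= n * n)%N by rewrite -mulSnr leq_mul2r iN orbT.
lia.
Qed.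

Lemma static_keeps (P P' : nat -> Prop) (s s' : state R) : static s ->
  keeps P s.1 s'.1 -> keeps P' s.2 s'.2 ->
  (forall a, (a <= 4)%N \/ (Ab <= a < xb)%N -> P a) -> (forall a, (a <= 13)%N -> P' a) ->
  static s'.
Proof.
move=> [] ? ? ? ? ? ? ? ? ? ? ? ? ? ? ? ? ? mat kr kn PP PP'.
split; rewrite ?kn ?kr //; try (by apply: PP'); try (by apply: PP; left).
move=> k i j; rewrite kr //; apply: PP; right; have := mat_index_lt k i j.
by have [_ ?] := xb_ge; lia.
Qed.

Ltac get_static st :=
  move: (st_n st) (st_m st) (st_z st) (st_o st) (st_T st) (st_Ab st) (st_xb st)
    (st_yb st) (st_hb st) (st_cb st) (st_qb st) (st_nb st) (st_0 st) (st_1 st)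
    (st_2 st) (st_3 st) (st_TR st);
  move=> /= N0 N1 N2 N3 N6 N7 N8 N9 N10 N11 N12 N13 r0 r1 r2 r3 r4.

Ltac usim := repeat first [rewrite upd_eq | rewrite upd_ne; [|by first [exact: isT|lia]]].

Ltac keeps_tac := repeat (apply: keeps_upd; last by lia); try exact: keeps_refl.

(** * Reading a vertex number digit by digit *)

Lemma decode_digit_spec s p a b k : static s -> (0 < p)%N -> (a < 3 * p)%N ->
  s.2 14 = (xb + k)%N -> s.2 15 = b -> s.2 16 = (b * T)%N ->
  s.1 6 = (3 * p)%:R -> s.1 5 = a%:R ->
  W decode_digit s 25 (fun s' => exists d, [/\ (d * p <= a < d * p + p)%N,
    s'.2 14 = (xb + k.+1)%N,
    s'.2 15 = (3 * b + d)%N /\ s'.2 16 = ((3 * b + d) * T)%N,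
    [/\ s'.1 6 = p%:R, s'.1 5 = (a - d * p)%:R & s'.1 (xb + k)%N = dval R d] &
    keeps (fun c => ~ (5 <= c <= 7)%N /\ c <> xb + k)%N s.1 s'.1 /\
    keeps (fun c => ~ (14 <= c <= 17))%N s.2 s'.2]).
Proof.
case: s => r N st p0 a3 /= i14 i15 i16 i6 i5.
get_static st; have [x32 _] := xb_ge.
clear TE AbE xbE ybE hbE cbE qbE nbE.
have pR : (3 * p)%:R / 3 = p%:R :> R by rewrite natrM mulrAC divff ?mul1r // pnatr_eq0.
rewrite /decode_digit; apply: (W_blk_seq (t1 := 19)); [by []| |by []].
rewrite /exec_blk /step /=; usim; rewrite i14 i15 i16 i6 r0 r3 pR.
have -> : (b + b + b = 3 * b)%N by lia.
have -> : (b * T + b * T + b * T = 3 * b * T)%N by lia.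
apply: (W_cat (t1 := 13) (t2 := 1)) => //.
apply: W_ifr => /=; usim; rewrite i5 ?ler_nat ?ltr_nat => pa.
- apply: (W_blk_seq (t1 := 7)); [by []| |by []].
  rewrite /exec_blk /step /=; usim; rewrite i5 i14 r1 N3 N6 -natrB //.
  apply: W_ifr => /=; usim; rewrite ?ler_nat ?ltr_nat => pb.
  + apply: W_blk => //; rewrite /exec_blk /step /=; usim; rewrite N3 N6 r0 r1 i14.
    apply: W_blk => //; rewrite /exec_blk /step /=; usim; rewrite N3 i14 -natrB //.
    exists 2%N; split; try lia.
    * by split=> //; [congr _%:R; lia | rewrite /dval /= sub0r].
    * by split; keeps_tac.
  + apply: W_blk => //; apply: W_blk => //; rewrite /exec_blk /step /=; usim.
    rewrite N3 i14; exists 1%N; split; try lia.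
    * by split=> //; congr _%:R; lia.
    * by split; keeps_tac.
- apply: W_blk => //; apply: W_blk => //; rewrite /exec_blk /step /=; usim.
  rewrite N3 i14; exists 0%N; split; try lia.
  + by rewrite i5; split=> //; congr _%:R; lia.
  + by split; keeps_tac.
Qed.

Definition keepsD (a : nat) : Prop := ~ (5 <= a <= 7)%N /\ ~ (xb <= a < yb)%N.
Definition keepsDN (a : nat) : Prop := ~ (14 <= a <= 17)%N.

Lemma decode_spec s u : static s -> (u < T)%N -> s.1 5 = u%:R ->
  W decode s (32 * n + 5) (fun s' => [/\ s'.2 15 = u, s'.2 16 = (u * T)%N,
    forall i : 'I_n, s'.1 (xb + i)%N = dvec R n u i ord0,
    keeps keepsD s.1 s'.1 & keeps keepsDN s.2 s'.2]).
Proof.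
case: s => r N st uT /= i5; get_static st.
have sk s' : keeps keepsD r s'.1 -> keeps keepsDN N s'.2 -> static s'.
  move=> kr kN; apply: static_keeps st kr kN _ _ => a.
    have [x32 _] := xb_ge; rewrite /keepsD; clear -x32 AbE ybE; lia.
  by rewrite /keepsDN; clear; lia.
rewrite /decode; apply: (W_blk_seq (t1 := 32 * n + 1)); [by []| |by rewrite /=; clear; lia].
rewrite /exec_blk /step /=; usim; rewrite r0 r4 N8 N2.
(* After [k] digits the leading part of [u] sits in the index registers, and the part still to be
   read in real register 5. *)
pose I k (s' : state R) := [/\ s'.2 14 = (xb + k)%N,
  s'.2 15 = (u %/ 3 ^ (n - k))%N /\ s'.2 16 = (u %/ 3 ^ (n - k) * T)%N,
  s'.1 6 = (3 ^ (n - k))%:R /\ s'.1 5 = (u %% 3 ^ (n - k))%:R,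
  forall i : 'I_n, (i < k)%N -> s'.1 (xb + i)%N = dvec R n u i ord0 &
  keeps keepsD r s'.1 /\ keeps keepsDN N s'.2].
have uT' : (u < 3 ^ n)%N by rewrite -TE.
apply: (W_forn (I := I) (k0 := 0%N) (k1 := n) (tb := 25)) => //.
- rewrite /I /=; usim; rewrite subn0 divn_small // modn_small // mul0n TE addn0 addr0.
  split=> //; split.
    by repeat (apply: keeps_upd; last by rewrite /keepsD; clear; lia).
  by repeat (apply: keeps_upd; last by rewrite /keepsDN; clear; lia).
- move=> k s' /andP[_ kn] [j14 [j15 j16] [j6 j5] jx [kr kN]]; have st' := sk _ kr kN.
  split; first by rewrite (st_yb st') j14 ybE; clear -kn; lia.
  have [p [p0 pE pE']] : exists p,
      [/\ (0 < p)%N, (3 ^ (n - k.+1) = p)%N & (3 ^ (n - k) = 3 * p)%N].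
    exists (3 ^ (n - k.+1))%N; split; rewrite ?expn_gt0 // -expnS; congr expn.
    by clear -kn; lia.
  rewrite pE' in j15 j16 j6 j5.
  have a3 : (u %% (3 * p) < 3 * p)%N by rewrite ltn_pmod // muln_gt0.
  have [dE mE] := div_digit u p0.
  apply: W_impl (decode_digit_spec st' p0 a3 j14 j15 j16 j6 j5) _ _ => // s'' [d].
  move=> [da l14 [l15 l16] [l6 l5 lx] [kr' kN']].
  have dE' : (u %% (3 * p) %/ p = d)%N.
    clear -da p0; move: (u %% (3 * p))%N da => a da.
    have : (a %/ p < d.+1)%N by rewrite ltn_divLR // mulSn addnC; lia.
    have : (d <= a %/ p)%N by rewrite leq_divRL //; lia.
    by move: (a %/ p)%N => x; clear; lia.
  rewrite /I pE dE mE dE'; split=> //.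
  + move=> i; rewrite ltnS leq_eqVlt => /predU1P[ik|ik].
      rewrite ik lx mxE ik /dg pE dE dE' mulnC modnMDl modn_small // -dE' ltn_divLR //.
    by rewrite kr' ?jx //; have [x32 _] := xb_ge; clear -ik x32; lia.
  + split; first by apply: keeps_trans kr kr' _ => c; rewrite /keepsD ybE; clear -kn; lia.
    exact: keeps_trans kN kN' _.
- move=> s' [j14 [j15 j16] _ jx [kr kN]]; rewrite subnn expn0 !divn1 in j15 j16.
  have st' := sk _ kr kN; split; first by rewrite (st_yb st') j14 ybE.
  by split=> // i; exact: jx.
- by clear; lia.
Qed.

(** * One edge of the automaton: matrix-vector product and code of the image *)

Definition keepsE (a : nat) : Prop := ~ (5 <= a <= 9)%N /\ ~ (yb <= a < hb)%N.
Definition keepsEN (a : nat) : Prop := ~ (a = 14 \/ a = 17 \/ 19 <= a <= 21)%N.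

Lemma static_keepsE s s' : static s -> keeps keepsE s.1 s'.1 -> keeps keepsEN s.2 s'.2 ->
  static s'.
Proof.
move=> st kr kN; apply: static_keeps st kr kN _ _ => a.
  have [x32 _] := xb_ge; rewrite /keepsE; clear -x32 AbE ybE; lia.
by rewrite /keepsEN; clear; lia.
Qed.

Lemma edge_row_spec (k : 'I_m) (x : 'cV[R]_n) (i : 'I_n) s : static s ->
  (forall j : 'I_n, s.1 (xb + j)%N = x j ord0) ->
  s.2 19 = (yb + i)%N -> s.2 20 = (Ab + (k * n * n + i * n))%N ->
  W edge_row s (8 * n + 5) (fun s' => [/\ s'.2 19 = (yb + i.+1)%N,
    s'.2 20 = (Ab + (k * n * n + i.+1 * n))%N,
    s'.1 (yb + i)%N = (A k *m x) i ord0,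
    keeps (fun a => ~ (5 <= a <= 9)%N /\ a <> yb + i)%N s.1 s'.1 &
    keeps keepsEN s.2 s'.2]).
Proof.
case: s => r N st /= xE i19 i20; get_static st; have [x32 _] := xb_ge.
apply: (W_blk_seq (t1 := 8 * n + 3)); [by []| |by rewrite /=; clear; lia].
rewrite /exec_blk /step /=; usim; rewrite r0 N8 N2 addn0 addr0.
pose J j (s' : state R) := [/\ s'.2 14 = (xb + j)%N,
  s'.2 20 = (Ab + (k * n * n + i * n + j))%N,
  s'.1 5 = \sum_(l < n | (l < j)%N) A k i l * x l ord0,
  keeps (fun a => ~ (5 <= a <= 9)%N) r s'.1 &
  keeps (fun a => ~ (a = 14 \/ a = 20))%N N s'.2].
apply: (W_seq (t1 := 8 * n + 1) (t2 := 2) (Q1 := J n)); last by clear; lia.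
- apply: (W_forn (I := J) (k0 := 0%N) (k1 := n) (tb := 6)) => //.
  + rewrite /J /=; usim; rewrite addn0 big_pred0 //; split=> //; first by rewrite i20 addn0.
      by apply: keeps_upd => //; clear; lia.
    by apply: keeps_upd => //; clear; lia.
  + move=> j [r' N'] /andP[_ jn] [/= j14 j20 j5 kr kN]; rewrite (kN 9); last by clear; lia.
    split; first by rewrite N9 j14 ybE; clear -jn; lia.
    have E6 : r' (Ab + (k * n * n + i * n + j))%N = A k i (Ordinal jn).
      rewrite kr; first exact: (st_mat st k i (Ordinal jn)).
      by clear -AbE; lia.
    have E7 : r' (xb + j)%N = x (Ordinal jn) ord0.
      by rewrite kr; [exact: (xE (Ordinal jn)) | clear -x32; lia].
    apply: W_blk => //; rewrite /exec_blk /step /=; usim.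
    rewrite j14 upd_ne; last by clear -x32; lia.
    have k3 : N' 3 = 1%N by rewrite kN ?N3 //; clear; lia.
    rewrite j20 E6 E7.
    split=> /=; usim.
    * by rewrite j14 k3; clear; lia.
    * by rewrite k3; clear; lia.
    * by rewrite (sum_ord_lt_recr (Ordinal jn)) j5.
    * by repeat (apply: keeps_upd; last by clear; lia).
    * by repeat (apply: keeps_upd; last by clear; lia).
  + move=> [r' N'] /= J'; case: (J') => /= j14 j20 j5 kr kN; split=> //.
    have k9 : N' 9 = yb by rewrite kN ?N9 //; clear; lia.
    by rewrite /= k9 j14 ybE.
  + by clear; lia.
- move=> [r' N'] [/= j14 j20 j5 kr kN]; apply: W_blk => //; rewrite /exec_blk /step /=; usim.
  have k3 : N' 3 = 1%N by rewrite kN ?N3 //; clear; lia.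
  have k19 : N' 19 = (yb + i)%N by rewrite kN ?i19 //; clear; lia.
  rewrite k3 k19.
  split=> /=; usim.
  + by clear; lia.
  + by rewrite j20 mulSn; clear; lia.
  + by rewrite j5 mxE; apply: eq_bigl => l; rewrite ltn_ord.
  + apply: keeps_upd; last by clear; lia.
    by apply: keeps_sub kr _ => c []; clear.
  + apply: keeps_upd; last by rewrite /keepsEN; clear; lia.
    by apply: keeps_sub kN _ => c; rewrite /keepsEN; clear; lia.
Qed.

Lemma edge_mul_spec (k : 'I_m) (x : 'cV[R]_n) s : static s ->
  (forall j : 'I_n, s.1 (xb + j)%N = x j ord0) -> s.2 20 = (Ab + k * n * n)%N ->
  W edge_mul s (n * (8 * n + 7) + 2) (fun s' => [/\ s'.2 20 = (Ab + k.+1 * n * n)%N,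
    forall i : 'I_n, s'.1 (yb + i)%N = (A k *m x) i ord0,
    keeps keepsE s.1 s'.1 & keeps keepsEN s.2 s'.2]).
Proof.
case: s => r N st /= xE i20; get_static st; have [x32 _] := xb_ge.
apply: (W_blk_seq (t1 := n * (8 * n + 7) + 1)); [by []| |by rewrite /= addnC; clear; lia].
rewrite /exec_blk /step /=; usim; rewrite N9 N2 addn0.
pose I i (s' : state R) := [/\ s'.2 19 = (yb + i)%N,
  s'.2 20 = (Ab + (k * n * n + i * n))%N,
  forall i' : 'I_n, (i' < i)%N -> s'.1 (yb + i')%N = (A k *m x) i' ord0,
  keeps keepsE r s'.1 & keeps keepsEN N s'.2].
apply: (W_forn (I := I) (k0 := 0%N) (k1 := n) (tb := 8 * n + 5)) => //.
- rewrite /I /=; usim; split=> //; first by rewrite addn0.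
    by rewrite i20 mul0n addn0.
  by apply: keeps_upd => //; rewrite /keepsEN; clear; lia.
- move=> i s' /andP[_ li] [j19 j20 jy kr kN]; have st' := static_keepsE st kr kN.
  split; first by rewrite (st_hb st') j19 hbE; clear -li; lia.
  have xE' (j : 'I_n) : s'.1 (xb + j)%N = x j ord0.
    rewrite kr ?xE // /keepsE; have := ltn_ord j; clear -x32 ybE; lia.
  have RS := edge_row_spec (i := Ordinal li) st' xE' j19 j20.
  apply: W_impl RS _ _ => // s'' [l19 l20 ly kr' kN']; split=> //.
  + move=> i'; rewrite ltnS leq_eqVlt => /predU1P[ii|ii].
      by have -> : i' = Ordinal li by exact: val_inj.
    rewrite kr' ?jy //=; clear -x32 ybE ii; lia.
  + by apply: keeps_trans kr kr' _ => c; rewrite /keepsE hbE /=; clear -li; lia.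
  + exact: keeps_trans kN kN' _.
- move=> s' [j19 j20 jy kr kN]; have st' := static_keepsE st kr kN.
  split; first by rewrite (st_hb st') j19 hbE.
  split=> //; first by rewrite j20 !mulSn mulnDl; clear; lia.
  by move=> i; exact: jy.
- by rewrite subn0 -addnA.
Qed.

Lemma edge_range_spec (y : 'cV[R]_n) s : static s -> (0 < n)%N ->
  (forall i : 'I_n, s.1 (yb + i)%N = y i ord0) ->
  W edge_range s (10 * n + 4) (fun s' => exists a b : 'I_n,
    [/\ s'.1 8 = y a ord0 /\ s'.1 9 = y b ord0,
    forall i, y i ord0 <= y a ord0, forall i, y b ord0 <= y i ord0,
    keeps (fun a => ~ (5 <= a <= 9)%N) s.1 s'.1 &
    keeps (fun a => ~ (a = 19)%N) s.2 s'.2]).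
Proof.
case: s => r N st n0 /= yE; get_static st; have [x32 _] := xb_ge.
have ky (i : 'I_n) (r' : nat -> R) : keeps (fun a => ~ (5 <= a <= 9)%N) r r' ->
    r' (yb + i)%N = y i ord0.
  by move=> kr; rewrite kr ?yE // ybE; clear -x32; lia.
apply: (W_blk_seq (t1 := 10 * n + 1)); [by []| |by rewrite /=; clear; lia].
rewrite /exec_blk /step /=; usim; rewrite N9 N2 addn0.
have y0 : r yb = y (Ordinal n0) ord0 by rewrite -yE addn0.
rewrite upd_ne ?y0; last by rewrite ybE; clear -x32; lia.
pose I k (s' : state R) := exists a b : 'I_n,
  [/\ s'.2 19 = (yb + k)%N, s'.1 8 = y a ord0 /\ s'.1 9 = y b ord0,
  forall i : 'I_n, (i < k)%N -> y b ord0 <= y i ord0 <= y a ord0,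
  keeps (fun a => ~ (5 <= a <= 9)%N) r s'.1 &
  keeps (fun a => ~ (a = 19)%N) N s'.2].
apply: (W_forn (I := I) (k0 := 0%N) (k1 := n) (tb := 8)) => //.
- exists (Ordinal n0), (Ordinal n0); rewrite /=; usim; split=> //; first by rewrite addn0.
    by repeat (apply: keeps_upd; last by clear; lia).
  by repeat (apply: keeps_upd; last by clear; lia).
- move=> k [r' N'] /andP[_ kn] [a [b [/= j19 [j8 j9] jy kr kN]]].
  have k10 : N' 10 = hb by rewrite kN ?N10.
  have k3 : N' 3 = 1%N by rewrite kN ?N3.
  have k0 : r' 0%N = 0 by rewrite kr ?r0.
  split; first by rewrite k10 j19 hbE; clear -kn; lia.
  pose ik := Ordinal kn; have yk : r' (yb + k)%N = y ik ord0 by exact: (ky ik).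
  apply: (W_blk_seq (t1 := 7)); [by []| |by []].
  rewrite /exec_blk /step /=; rewrite j19 yk.
  (* Common ending of the four outcomes of the two comparisons; [a'] and [b'] locate the updated
     extremes. *)
  have fin a' b' (s' : state R) : s'.1 8 = y a' ord0 -> s'.1 9 = y b' ord0 ->
      s'.2 = N' -> keeps (fun a => ~ (5 <= a <= 9)%N) r' s'.1 ->
      y b' ord0 <= y b ord0 -> y a ord0 <= y a' ord0 ->
      y b' ord0 <= y ik ord0 <= y a' ord0 ->
      W (Blk [:: NAdd 19 19 3]) s' 1 (I k.+1).
    case: s' => r'' N'' /= l8 l9 -> kr' bb aa ybk.
    apply: W_blk => //; exists a', b'; rewrite /exec_blk /step /=; usim; split=> //.
    + by rewrite j19 k3; clear; lia.
    + move=> i; rewrite ltnS leq_eqVlt => /predU1P[ii|/jy/andP[bi ia]].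
        by have -> : i = ik by exact: val_inj.
      by rewrite (le_trans bb bi) (le_trans ia aa).
    + exact: keeps_trans kr kr' _.
    + by apply: keeps_upd => // /(_ erefl).
  apply: (W_cat (t1 := 3) (t2 := 4)) => //.
  apply: W_ifr => /=; usim; rewrite j8 => cmp1; apply: W_blk => //;
    rewrite /exec_blk /step /=; usim;
    (apply: (W_cat (t1 := 3) (t2 := 1)) => //; apply: W_ifr => /=; usim; rewrite j9 => cmp2;
    apply: W_blk => //; rewrite /exec_blk /step /=; usim).
  + apply: (fin a b) => //=; usim => //; last by rewrite cmp1 cmp2.
    by repeat (apply: keeps_upd; last by clear; lia).
  + apply: (fin a ik) => //=; usim; rewrite ?k0 ?addr0 ?cmp1 ?lexx ?(ltW cmp2) //.
    by repeat (apply: keeps_upd; last by clear; lia).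
  + apply: (fin ik b) => //=; usim; rewrite ?k0 ?addr0 ?cmp2 ?lexx ?(ltW cmp1) //.
    by repeat (apply: keeps_upd; last by clear; lia).
  + apply: (fin ik ik) => //=; usim; rewrite ?k0 ?addr0 ?lexx ?(ltW cmp1) ?(ltW cmp2) //.
    by repeat (apply: keeps_upd; last by clear; lia).
- move=> s' [a [b [j19 j89 jy kr kN]]].
  split; first by rewrite (kN 10) //= N10 j19 hbE.
  exists a, b; split=> // i; first by case/andP: (jy i (ltn_ord i)).
  by case/andP: (jy i (ltn_ord i)).
- by clear; lia.
Qed.

Lemma edge_code_spec (y : 'cV[R]_n) (a b : 'I_n) s : static s -> pnorm y <= 1 ->
  (forall i : 'I_n, s.1 (yb + i)%N = y i ord0) ->
  s.1 8 = y a ord0 -> s.1 9 = y b ord0 ->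
  (forall i, y i ord0 <= y a ord0) -> (forall i, y b ord0 <= y i ord0) ->
  W edge_code s (12 * n + 6) (fun s' => [/\ s'.2 21 = code y,
    keeps (fun a => ~ (5 <= a <= 9)%N) s.1 s'.1 &
    keeps (fun a => ~ (a = 17 \/ a = 19 \/ a = 21)%N) s.2 s'.2]).
Proof.
case: s => r N st y1 /= yE i8 i9 ya yb'; get_static st; have [x32 _] := xb_ge.
have ky (i : 'I_n) (r' : nat -> R) : keeps (fun a => ~ (5 <= a <= 9)%N) r r' ->
    r' (yb + i)%N = y i ord0.
  by move=> kr; rewrite kr ?yE // ybE; clear -x32; lia.
apply: (W_blk_seq (t1 := (12 * n + 1).+2)); [by []| |by rewrite /=; clear; lia].
rewrite /exec_blk /step /=; usim; rewrite N9 N2 addn0 i8 i9.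
apply: W_ifr; rewrite /=; usim; rewrite r2 => cmp; last first.
  apply: W_blk => //; rewrite /exec_blk /=; usim; split.
  - apply/esym/code0P => //; apply/pnorm_ltP => // i j.
    by have := ya i; have := yb' j; lra.
  - by repeat (apply: keeps_upd; last by clear; lia).
  - by repeat (apply: keeps_upd; last by clear; lia).
pose I k (s' : state R) := [/\ s'.2 19 = (yb + k)%N, s'.2 21 = hv (dig y) k,
  s'.1 8 = y a ord0 /\ s'.1 9 = y b ord0,
  keeps (fun a => ~ (5 <= a <= 9)%N) r s'.1 &
  keeps (fun a => ~ (a = 17 \/ a = 19 \/ a = 21)%N) N s'.2].
apply: (W_forn (I := I) (k0 := 0%N) (k1 := n) (tb := 10)) => //.
- rewrite /I /=; usim; split=> //; first by rewrite addn0.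
    by repeat (apply: keeps_upd; last by clear; lia).
  by repeat (apply: keeps_upd; last by clear; lia).
- move=> k [r' N'] /andP[_ kn] [/= j19 j21 [j8 j9] kr kN].
  have k10 : N' 10 = hb by rewrite kN ?N10 //; clear; lia.
  have k3 : N' 3 = 1%N by rewrite kN ?N3 //; clear; lia.
  split; first by rewrite k10 j19 hbE; clear -kn; lia.
  pose ik := Ordinal kn; have yk : r' (yb + k)%N = y ik ord0 by exact: (ky ik).
  apply: (W_blk_seq (t1 := 7)); [by []| |by []].
  rewrite /exec_blk /step /=; usim; rewrite j19 j21 yk.
  have dk : dig y k = digit y ik by rewrite /dig insubT.
  rewrite (digit_range _ y1 ya yb' cmp) in dk.
  have fin d (s' : state R) : s'.1 = upd r' 5 (y ik ord0) -> s'.2 19 = (yb + k)%N ->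
      s'.2 21 = (hv (dig y) k * 3 + d)%N -> d = dig y k ->
      keeps (fun a => ~ (a = 17 \/ a = 19 \/ a = 21)%N) N' s'.2 ->
      W (Blk [:: NAdd 19 19 3]) s' 1 (I k.+1).
    case: s' => r'' N'' /= -> l19 l21 dE kN'.
    have l3 : N'' 3 = 1%N by rewrite kN' ?k3 //; clear; lia.
    apply: W_blk => //; rewrite /exec_blk /step /I /=; usim; split=> //.
    + by rewrite l19 l3; clear; lia.
    + by rewrite l21 dE.
    + by repeat (apply: keeps_upd; last by clear; lia).
    + apply: keeps_upd; last by clear; lia.
      exact: keeps_trans kN kN' _.
  apply: (W_cat (t1 := 6) (t2 := 1)) => //.
  apply: W_ifr => /=; usim; rewrite j8 => cmp1.
    apply: W_blk => //; rewrite /exec_blk /step /=; usim.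
    apply: (fin 1%N) => //=; usim; rewrite ?k3 ?dk ?cmp1 //; first by clear; lia.
    by repeat (apply: keeps_upd; last by clear; lia).
  apply: W_ifr => /=; usim; rewrite j9 => cmp2;
    apply: W_blk => //; rewrite /exec_blk /step /=; usim.
  + apply: (fin 2%N) => //=; usim; rewrite ?k3 ?dk ?(leNgt (y a ord0)) ?cmp1 ?cmp2 //.
      by clear; lia.
    by repeat (apply: keeps_upd; last by clear; lia).
  + apply: (fin 0%N) => //=; usim.
    * by clear; lia.
    * by rewrite dk !leNgt cmp1 cmp2.
    * by repeat (apply: keeps_upd; last by clear; lia).
- move=> s' [j19 j21 j89 kr kN].
  split=> //; rewrite (kN 10) /= ?N10 ?j19 ?hbE //; clear; lia.
- by clear; lia.
Qed.

Lemma edge_spec (k : 'I_m) u s : static s -> admissible (A k) -> (0 < n)%N ->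
  (forall j : 'I_n, s.1 (xb + j)%N = dvec R n u j ord0) ->
  s.2 20 = (Ab + k * n * n)%N ->
  W edge s (8 * n * n + 29 * n + 12) (fun s' => [/\ s'.2 20 = (Ab + k.+1 * n * n)%N,
    s'.2 21 = succ A k u, keeps keepsE s.1 s'.1 & keeps keepsEN s.2 s'.2]).
Proof.
move=> st Ak n0 xE i20.
apply: (W_seq (t1 := n * (8 * n + 7) + 2) (t2 := 22 * n + 10) (edge_mul_spec st xE i20)).
  move=> s1 [j20 jy kr1 kN1]; have st1 := static_keepsE st kr1 kN1.
  apply: (W_seq (t1 := 10 * n + 4) (t2 := 12 * n + 6) (edge_range_spec st1 n0 jy)).
    move=> s2 [a [b [[l8 l9] ya yb' kr2 kN2]]].
    have kr12 : keeps keepsE s.1 s2.1.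
      by apply: keeps_trans kr1 kr2 _ => c []; clear.
    have kN12 : keeps keepsEN s.2 s2.2.
      by apply: keeps_trans kN1 kN2 _ => c; rewrite /keepsEN; clear; lia.
    have st2 := static_keepsE st kr12 kN12.
    have jy2 (i : 'I_n) : s2.1 (yb + i)%N = (A k *m dvec R n u) i ord0.
      by rewrite kr2 ?jy //; have [x32 _] := xb_ge; rewrite ybE; clear -x32; lia.
    have y1 : pnorm (A k *m dvec R n u) <= 1.
      exact: le_trans (Ak.2 _) (pnorm_dvec R n u).
    apply: W_impl (edge_code_spec st2 y1 jy2 l8 l9 ya yb') _ _ => // s3 [m21 kr3 kN3].
    split=> //.
    - by rewrite kN3 ?kN2 ?j20 //; clear; lia.
    - by apply: keeps_trans kr12 kr3 _ => c []; clear.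
    - by apply: keeps_trans kN12 kN3 _ => c; rewrite /keepsEN; clear; lia.
  by clear; lia.
by rewrite mulnDr mulnCA mulnA; clear; lia.
Qed.
Hypotheses (Aadm : forall k, admissible (A k)) (n_gt0 : (0 < n)%N).

(** * Storing the reversed graph and the counters *)

Variable all : bool.

Record graph_mem (L : nat -> seq nat) (r : nat -> R) : Prop := GraphMem {
  gm_head : forall w, (w < T)%N -> r (hb + w)%N = (enc (L w))%:R;
  gm_next : forall v w, (v < T)%N -> (w < T)%N -> r (nb + v * T + w)%N = (nx (L w) v)%:R;
  gm_count : forall v, (v < T)%N -> r (cb + v)%N = (threshold all (deg T L v))%:R }.

Lemma graph_mem_keeps (P : nat -> Prop) L r r' : graph_mem L r -> keeps P r r' ->
  (forall a, (hb <= a)%N -> P a) -> graph_mem L r'.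
Proof.
by move=> [mh mn mc] kr hP; split=> *; rewrite kr ?mh ?mn ?mc //; apply: hP; lia.
Qed.

Definition keepsI (a : nat) : Prop := [/\ a <> 11, ~ (hb <= a < qb)%N & (a < nb)%N].

Lemma build_insert_spec L v w s : static s -> graph_mem L s.1 ->
  (v < T)%N -> (w < T)%N -> v \notin L w ->
  s.1 10 = v%:R -> s.2 15 = v -> s.2 21 = w -> s.2 23 = (nb + v * T + w)%N ->
  W (build_insert all) s 10 (fun s' => [/\ graph_mem (upd L w (v :: L w)) s'.1,
    keeps keepsI s.1 s'.1 & keeps (fun a => ~ (a = 14)) s.2 s'.2]).
Proof.
case: s => r N st /= [mh mn mc] vT wT vL i10 i15 i21 i23; get_static st.
have [x32 _] := xb_ge.
have h32 : (32 <= hb)%N by rewrite hbE ybE; clear -x32; lia.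
have [a aE] : exists a, a = (nb + v * T + w)%N by exists (nb + v * T + w)%N.
have na : (nb <= a)%N by rewrite aE; clear; lia.
rewrite -aE in i23.
clear x32 TE AbE xbE ybE hbE.
do 8 (apply: W_blk_step => //; rewrite /step /=; usim;
  rewrite ?(i23,i21,N10,i15,N11,r1,i10,mh,mc,natr1) //).
apply: W_blk_step => //; rewrite /step /=.
rewrite [X in _ + X](_ : _ = 1); last by usim.
(* [c] is the old counter in problem 1 and 0 in problem 2; adding 1 gives in both cases the
   threshold for one more out-neighbour. *)
set c := (X in upd _ _ (X + 1)).
have cE : c + 1 = (threshold all (deg T L v).+1)%:R.
  by rewrite /c /threshold; case: (all); usim; rewrite ?r0 ?add0r // natr1.
rewrite cE; apply: W_blk_step => //; rewrite /step /=; usim.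
apply: W_nil; split=> /=.
- have inj v' w' (w'T : (w' < T)%N) := pair_addr_inj (v := v') (v' := v) w'T wT.
  split=> [w' w'T|v' w' v'T w'T|v' v'T]; usim; rewrite /upd.
  + rewrite (_ : (hb + w' == a)%N = false); last by clear -na cbE qbE nbE w'T; lia.
    rewrite (_ : (hb + w' == 11)%N = false); last by clear -h32; lia.
    by rewrite eqn_add2l; case: eqVneq => // _; exact: mh.
  + have -> : (nb + v' * T + w' == a)%N = (v' == v) && (w' == w).
      rewrite aE -!addnA eqn_add2l; apply/eqP/andP => [/inj[]// -> ->|[/eqP-> /eqP->]] //.
    rewrite (_ : (nb + v' * T + w' == 11)%N = false); last by clear -h32 na cbE qbE nbE; lia.
    rewrite mn //; case: (eqVneq w' w) => [->|_]; last by rewrite andbF.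
    by rewrite nx_cons andbT; case: eqVneq.
  + rewrite eqn_add2l deg_insert //; case: eqVneq => [->|_]; first by rewrite addn1.
    rewrite (_ : (cb + v' == a)%N = false); last by clear -na qbE nbE v'T; lia.
    rewrite (_ : (cb + v' == hb + w)%N = false); last by clear -cbE wT; lia.
    rewrite (_ : (cb + v' == 11)%N = false); last by clear -h32 cbE; lia.
    by rewrite addn0 mc.
- by repeat (apply: keeps_upd; last by rewrite /keepsI; case; clear -h32 na cbE qbE nbE vT wT; lia).
- by repeat (apply: keeps_upd; last by clear; lia).
Qed.

(** Edges met once the vertices before [v] are finished and the first [k] matrices have been applied
    to [v]. The sink contributes none. *)
Definition edges_below (v k v' w : nat) : Prop :=
  ((0 < v' < v)%N /\ exists k', succ A k' v' = w) \/
  (v' = v /\ exists2 k' : 'I_m, (k' < k)%N & succ A k' v = w).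

Record adjacency (v k : nat) (L : nat -> seq nat) : Prop := Adjacency {
  adj_uniq : forall w, uniq (L w);
  adj_mem : forall w, (w < T)%N -> forall v', v' \in L w <-> edges_below v k v' w;
  adj_total : (sources_total T L <= v.-1 * m + k)%N }.

Lemma adjacency_step v (k : 'I_m) L : adjacency v k L -> (0 < v)%N ->
  adjacency v k.+1 (if v \in L (succ A k v) then L
                    else upd L (succ A k v) (v :: L (succ A k v))).
Proof.
move=> [Lu Lm Lt] v0; set w := succ A k v; have wT : (w < T)%N by rewrite TE; exact: succ_lt.
have mem' u v' : (u < T)%N ->
    edges_below v k.+1 v' u <-> edges_below v k v' u \/ (v' = v /\ u = w).
  move=> uT; split=> [[h|[-> [k' kk' <-]]]|[[h|[-> [k' kk' <-]]]|[-> ->]]].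
  - by left; left.
  - move: kk'; rewrite ltnS leq_eqVlt => /predU1P[/val_inj ->|kk'].
      by right.
    by left; right; split=> //; exists k'.
  - by left.
  - by right; split=> //; exists k' => //; exact: ltnW.
  - by right; split=> //; exists k.
case: ifP => vL.
- split=> // [u uT v'|]; last by move: Lt; clear; lia.
  rewrite mem' // Lm //; split=> [|[//|[-> ->]]]; first by left.
  by apply/Lm.
- split=> [u|u uT v'|]; last by rewrite sources_total_insert //; move: Lt; clear; lia.
  + have [->|uw] := eqVneq u w; last by rewrite upd_ne.
    by rewrite upd_eq /= vL Lu.
  + rewrite mem' //; have [->|uw] := eqVneq u w; last first.
      rewrite upd_ne // Lm //; split=> [|[//|[_ uw']]]; first by left.
      by rewrite uw' eqxx in uw.
    rewrite upd_eq in_cons; split=> [/predU1P[->|/Lm h]|[/Lm h|[-> _]]].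
    * by right.
    * by left; exact: h.
    * by rewrite h // orbT.
    * by rewrite eqxx.
Qed.

Definition queue_zero (r : nat -> R) : Prop := forall i, (i < T)%N -> r (qb + i)%N = 0.

Definition inv_build_edge (v k : nat) (s : state R) : Prop :=
  [/\ static s, s.2 22 = k /\ s.2 20 = (Ab + k * n * n)%N,
   s.1 10 = v%:R /\ s.2 15 = v /\ s.2 16 = (v * T)%N,
   forall j : 'I_n, s.1 (xb + j)%N = dvec R n v j ord0 &
   queue_zero s.1 /\ exists2 L, adjacency v k L & graph_mem L s.1].

Lemma build_edge_spec v (k : 'I_m) s : (0 < v < T)%N -> inv_build_edge v k s ->
  W (build_edge all) s (8 * n * n + 29 * n + 28) (inv_build_edge v k.+1).
Proof.
move=> /andP[v0 vT] [st [i22 i20] [i10 [i15 i16]] xE [q0 [L adj gm]]].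
have [x32 _] := xb_ge.
have hx : (32 <= hb /\ xb <= hb)%N by rewrite hbE ybE; clear -x32; lia.
apply: (W_seq (t2 := 16) (edge_spec (u := v) st (Aadm k) n_gt0 xE i20)); last by clear; lia.
move=> [r N] [/= j20 j21 kr kN]; have st' := static_keepsE (s' := (r, N)) st kr kN.
have gm' : graph_mem L r.
  apply: (graph_mem_keeps gm kr) => a; rewrite /keepsE; clear -hx; lia.
have q0' : queue_zero r.
  move=> i iT; rewrite kr ?q0 // /keepsE; clear -hx qbE cbE; lia.
have xE' (j : 'I_n) : r (xb + j)%N = dvec R n v j ord0.
  rewrite kr ?xE // /keepsE; have := ltn_ord j; clear -x32 ybE; lia.
have k15 : N 15 = v by rewrite kN ?i15 // /keepsEN; clear; lia.
have k16 : N 16 = (v * T)%N by rewrite kN ?i16 // /keepsEN; clear; lia.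
have k22 : N 22 = k by rewrite kN ?i22 // /keepsEN; clear; lia.
have k10 : r 10 = v%:R by rewrite kr ?i10 // /keepsE; clear -hx ybE x32; lia.
set w := succ A k v in j21.
have wT : (w < T)%N by rewrite TE; exact: succ_lt.
get_static st'.
apply: (W_blk_seq (t1 := 12)); [by []| |by []].
rewrite /exec_blk /step /=; usim; rewrite N13 k16 j21 N3 k22.
have adj' := adjacency_step adj v0; rewrite -/w in adj'.
have vw := gm_next gm' vT wT; rewrite vw.
set r1' := upd r 11 _; set N1' := upd _ 22 _.
have st1 : static (r1', N1').
  apply: (static_keeps (P := fun a => a <> 11) (P' := fun a => (a < 14)%N) st').
  - by apply: keeps_upd; last by clear; lia.
  - by rewrite /N1'; repeat (apply: keeps_upd; last by clear; lia).
  - by clear -AbE; lia.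
  - by clear; lia.
have gm1 : graph_mem L r1'.
  apply: (graph_mem_keeps (P := fun a => a <> 11) gm').
  - by apply: keeps_upd; last by clear; lia.
  - by clear -hx; lia.
have q1 : queue_zero r1'.
  by move=> i iT; rewrite /r1' upd_ne ?q0' //; clear -hx qbE cbE; lia.
have xE1 (j : 'I_n) : r1' (xb + j)%N = dvec R n v j ord0.
  by rewrite /r1' upd_ne ?xE' //; clear -x32; lia.
apply: W_ifr => /=; rewrite /r1'; usim; rewrite -/r1' r0.
- rewrite lern0 => nx0; have vL : v \notin L w.
    by move: nx0; rewrite /nx; case: (v \in L w).
  rewrite (negPf vL) in adj'.
  apply: W_impl (build_insert_spec st1 gm1 vT wT vL _ _ _ _) _ _ => //=.
  + move=> s2 [gm2 kr2 kN2]; split=> /=.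
    * apply: (static_keeps st1 kr2 kN2) => a; last by clear; lia.
      by rewrite /keepsI => ax; split; clear -ax hx xbE AbE hbE ybE nbE qbE cbE; lia.
    * by rewrite !kN2 //; rewrite /N1'; usim; rewrite addn1.
    * have kI : keepsI 10 by split; clear -hx qbE cbE nbE; lia.
      by rewrite (kr2 _ kI) !kN2 // /r1' /N1'; usim; rewrite k10 k15 k16.
    * by move=> j; rewrite kr2 ?xE1 // /keepsI; split; have := ltn_ord j; clear -x32 hx hbE ybE nbE qbE cbE; lia.
    * split; last by eexists; [exact: adj'|].
      by move=> i iT; rewrite kr2 ?q1 // /keepsI; split; clear -hx hbE ybE nbE qbE cbE iT; lia.
- rewrite ltr0n => nx0; have vL : v \in L w.
    by move: nx0; rewrite /nx; case: (v \in L w).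
  rewrite vL in adj'; apply: W_nil; split=> //=.
  + by rewrite /N1'; usim; rewrite addn1.
  + by split=> //; exists L.
Qed.

Definition build_cost : nat := 8 * n * n + 29 * n + 30.

Definition inv_build (v : nat) (s : state R) : Prop :=
  [/\ static s, s.1 10 = v%:R, queue_zero s.1 &
   exists2 L, adjacency v 0 L & graph_mem L s.1].

Lemma adjacency_next v L : adjacency v m L -> (0 < v)%N -> adjacency v.+1 0 L.
Proof.
move=> [Lu Lm Lt] v0; split=> // [w wT v'|]; last first.
  by move: Lt; rewrite -{2}(prednK v0) mulSn; clear; lia.
rewrite Lm //; split=> [[[vv h]|[-> [k _ h]]]|[[vv h]|[_ [] //]]].
- by left; split=> //; clear -vv; lia.
- by left; split; [rewrite v0 /= | exists k].
- have [vE|vE] := eqVneq v' v.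
    by right; split=> //; case: h => k <-; exists k; rewrite ?vE.
  by left; split=> //; clear -vv vE; lia.
Qed.

Lemma build_vertex_spec v s : (0 < v < T)%N -> inv_build v s ->
  W (build_vertex all) s (32 * n + m * build_cost + 10) (inv_build v.+1).
Proof.
move=> /andP[v0 vT] [st i10 q0 [L adj gm]]; have [x32 _] := xb_ge.
have hx : (32 <= hb /\ xb <= hb)%N by rewrite hbE ybE; clear -x32; lia.
case: s st i10 q0 gm => r N st /= i10 q0 gm; get_static st.
apply: (W_blk_seq (t1 := (32 * n + m * build_cost + 9)%N)); [by []| |by rewrite /=; clear; lia].
rewrite /exec_blk /step /=; rewrite i10 r0 addr0.
have st1 : static (upd r 5 v%:R, N).
  apply: (static_keeps (P := fun a => a <> 5) (P' := fun a => (a < 14)%N) st) => //.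
  - by apply: keeps_upd; last by clear; lia.
  - by clear -AbE; lia.
apply: (W_seq (t1 := 32 * n + 5) (t2 := m * build_cost + 4) (decode_spec st1 vT _)).
- by rewrite /= upd_eq.
- move=> [r1' N1'] [/= j15 j16 jx kr kN].
  have kr1 : keeps (fun a => keepsD a /\ a <> 5) r r1'.
    apply: (keeps_trans (P' := keepsD) _ kr) => [|a []//].
    by apply: keeps_upd => // -[].
  have st2 : static (r1', N1').
    apply: (static_keeps (s' := (r1', N1')) st kr1 kN) => a; last by rewrite /keepsDN; clear; lia.
    by rewrite /keepsD => ax; clear -ax AbE xbE; lia.
  have gm2 : graph_mem L r1'.
    apply: (graph_mem_keeps gm kr1) => a; rewrite /keepsD; clear -hx hbE; lia.
  have q2 : queue_zero r1'.
    by move=> i iT; rewrite kr1 ?q0 // /keepsD; clear -hx qbE cbE hbE; lia.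
  have j10 : r1' 10 = v%:R.
    by rewrite kr1 ?i10 // /keepsD; clear -hx ybE x32; lia.
  clear N0 N1 N2 N3 N6 N7 N8 N9 N10 N11 N12 N13 r0 r1 r2 r3 r4; get_static st2.
  apply: (W_blk_seq (t1 := m * build_cost + 2)); [by []| |by rewrite /=; clear; lia].
  rewrite /exec_blk /step /=; usim; rewrite N7 N2 addn0.
  apply: (W_seq (t1 := m * build_cost + 1) (t2 := 1) (Q1 := inv_build_edge v m)).
  + apply: (W_forn (I := inv_build_edge v) (k0 := 0%N) (k1 := m) (tb := 8 * n * n + 29 * n + 28)) => //.
    * split=> /=; usim=> //; last by split=> //; exists L.
        apply: (static_keeps (P := fun=> True) (P' := fun a => (a < 14)%N) st2) => //=.
        by repeat (apply: keeps_upd; last by clear; lia).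
      by rewrite !mul0n addn0.
    * move=> k s2 /andP[_ km] inv2; have [st3 [k22 _] _ _ _] := inv2.
      split; first by rewrite (st_m st3) k22.
      by apply: (@build_edge_spec v (Ordinal km)); rewrite ?v0 ?vT.
    * move=> s2 inv2; have [st3 [k22 _] _ _ _] := inv2.
      by rewrite (st_m st3) k22.
    * by rewrite subn0 /build_cost -addnA leqnn.
  + move=> [r3' N3'] [/= st3 _ [k10 _] _ [q3 [L' adj' gm']]]; have /= r31 := st_1 st3.
    apply: W_blk => //; rewrite /exec_blk /step /= k10 r31 natr1.
    have k10' : keeps (fun a => a <> 10) r3' (upd r3' 10 v.+1%:R).
      by apply: keeps_upd => //; apply.
    split=> /=; usim => //.
    * apply: (static_keeps (s' := (_, _)) (P' := fun a => (a < 14)%N) st3 k10') => //.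
      by clear -AbE; lia.
    * by move=> i iT; rewrite k10' ?q3 //; clear -hx qbE cbE; lia.
    * exists L'; first exact: adjacency_next.
      by apply: (graph_mem_keeps gm' k10'); clear -hx; lia.
  + by clear; lia.
- by clear; lia.
Qed.

Lemma build_spec s : static s -> (forall a, (hb <= a)%N -> s.1 a = 0) ->
  W (build all) s (T * (32 * n + m * build_cost + 12)) (inv_build T).
Proof.
case: s => r N st /= zero; get_static st; have [x32 _] := xb_ge.
have T1 : (0 < T)%N by rewrite TE expn_gt0.
have hx : (32 <= hb)%N by rewrite hbE ybE; clear -x32; lia.
set tb := (32 * n + m * build_cost + 10)%N.
have -> : (32 * n + m * build_cost + 12 = tb + 2)%N by rewrite /tb; clear; lia.
rewrite /build; apply: (W_blk_seq (t1 := (T - 1) * (tb + 2) + 1)); [by []| |]; last first.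
  by rewrite /= -{2}(subnK T1) mulnDl; clear; lia.
rewrite /exec_blk /step /= r1 r0 addr0.
have k10 : keeps (fun a => a <> 10) r (upd r 10 1).
  by apply: keeps_upd => //; apply.
apply: (W_forr (I := inv_build) (k0 := 1%N) (k1 := T) (tb := tb)) => //.
- split=> /=; usim => //.
  + apply: (static_keeps (s' := (_, _)) (P' := fun a => (a < 14)%N) st k10) => //.
    by clear -AbE; lia.
  + by move=> i iT; rewrite k10 ?zero //; clear -hx qbE cbE; lia.
  (* The untouched zero memory already encodes empty lists, absent edges and zero counters. *)
  + exists (fun=> [::]).
      split=> // [w _ v'|]; last by rewrite /sources_total big1.
      by split=> // -[[]|[_ []]] //; case: v'.
    have d0 v : deg T (fun=> [::]) v = 0%N by rewrite /deg big1.
    split=> [w wT|v w vT wT|v vT]; rewrite k10 ?zero ?d0 /threshold ?if_same //;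
      clear -hx nbE qbE cbE; lia.
- move=> v s /andP[v0 vT] inv; have [st' k10' _ _] := inv.
  by rewrite k10' (st_TR st') ltr_nat; split=> //; apply: build_vertex_spec => //; rewrite v0.
- by move=> s inv; have [st' k10' _ _] := inv; rewrite k10' (st_TR st').
Qed.

(** * Backward peeling from the sink with a queue *)

Section Traverse.
Variable L : nat -> seq nat.
Hypotheses (L_uniq : forall w, uniq (L w))
  (L_lt : forall w v, (w < T)%N -> v \in L w -> (0 < v < T)%N).
Let c0 v := threshold all (deg T L v).
Hypothesis c0_gt0 : forall v, (0 < v < T)%N -> (0 < c0 v)%N.

Definition hits (D : seq nat) (v : nat) : nat := count (fun w => v \in L w) D.

(* [Q] lists the peeled vertices in order of discovery, and [h v] is the number of
   out-neighbours of [v] that have been processed. *)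
Record peeling (h : nat -> nat) (Q : seq nat) : Prop := Peeling {
  pl_uniq : uniq Q;
  pl_lt : forall v, v \in Q -> (v < T)%N;
  pl_head : exists q, Q = 0%N :: q;
  pl_rank : forall v, v \in Q -> v != 0%N -> (c0 v <= hits (take (index v Q) Q) v)%N;
  pl_closed : forall v, (0 < v < T)%N -> (v \in Q) = (c0 v <= h v)%N }.

(** The counter is a difference of reals, since hits may exceed the threshold. *)
Record peel_mem (h : nat -> nat) (Q : seq nat) (s : state R) : Prop := PeelMem {
  pm_head : forall w, (w < T)%N -> s.1 (hb + w)%N = (enc (L w))%:R;
  pm_next : forall v w, (v < T)%N -> (w < T)%N ->
    s.1 (nb + v * T + w)%N = (nx (L w) v)%:R;
  pm_count : forall v, (v < T)%N -> s.1 (cb + v)%N = (c0 v)%:R - (h v)%:R;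
  pm_queue : forall i, (i < size Q)%N -> s.1 (qb + i)%N = (nth 0%N Q i)%:R;
  pm_end : s.2 25 = (qb + size Q)%N }.

Lemma peel_mem_keeps (P P' : nat -> Prop) h Q s s' : peel_mem h Q s ->
  keeps P s.1 s'.1 -> keeps P' s.2 s'.2 -> (forall a, (hb <= a)%N -> P a) -> P' 25 ->
  peel_mem h Q s'.
Proof.
move=> [mh mn mc mq me] kr kN hP P25; split=> *;
  rewrite ?kr ?kN ?mh ?mn ?mc ?mq ?me //; apply: hP; lia.
Qed.

Lemma peeling_size h Q : peeling h Q -> (size Q <= T)%N.
Proof.
move=> [Qu Qlt _ _ _]; rewrite -(size_iota 0 T); apply: uniq_leq_size Qu _ => v vQ.
by rewrite mem_iota /= Qlt.
Qed.

Lemma hits_take D i v : (hits (take i D) v <= hits D v)%N.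
Proof. by rewrite /hits -{2}(cat_take_drop i D) count_cat leq_addr. Qed.

Lemma peeling_skip h Q v : peeling h Q -> (c0 v != (h v).+1)%N ->
  peeling (fun u => h u + (u == v))%N Q.
Proof.
move=> [Qu Qlt Qh Qr Qc] ne; split=> // u uT; rewrite Qc //.
by case: eqVneq => [->|_]; [move: ne; clear; lia | rewrite addn0].
Qed.

(** [v] is one hit short of its threshold, hence not yet listed; the bound by [hits Q v] says that
    the required out-neighbours already precede it, which is the rank condition. *)
Lemma peeling_push h Q v : peeling h Q -> (0 < v < T)%N -> c0 v = (h v).+1 ->
  ((h v).+1 <= hits Q v)%N -> peeling (fun u => h u + (u == v))%N (rcons Q v).
Proof.
move=> [Qu Qlt [q QE] Qr Qc] vT cv hv1.
have vQ : v \notin Q by rewrite Qc // cv ltnn.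
split=> [|u|||u uT].
- by rewrite rcons_uniq vQ.
- by rewrite mem_rcons in_cons => /predU1P[->|/Qlt//]; case/andP: vT.
- by exists (rcons q v); rewrite QE.
- move=> u; rewrite -cats1 mem_cat index_cat mem_seq1 => uQv u0.
  have [uQ|uQ] := boolP (u \in Q).
    by rewrite takel_cat ?index_size ?Qr.
  move: uQv; rewrite (negPf uQ) /= => /eqP ->; rewrite eqxx addn0 take_size_cat //.
  by rewrite cv.
- rewrite mem_rcons in_cons Qc //; case: eqVneq => [->|_]; last by rewrite addn0.
  by rewrite cv addn1 leqnn.
Qed.

(** [D] holds the fully processed vertices, [w] is in progress, [l1] are its sources already visited
    and [l2] those to come. *)
Definition inv_edge (D : seq nat) (w k : nat) (s : state R) : Prop :=
  exists l1 l2 Q, [/\ L w = l1 ++ l2 /\ size l1 = k,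
    static s,
    take (size D).+1 Q = rcons D w,
    s.1 10 = (enc l2)%:R /\ s.2 24 = (qb + (size D).+1)%N /\ s.2 26 = w &
    let h v := (hits D v + (v \in l1))%N in peeling h Q /\ peel_mem h Q s].

Lemma traverse_edge_spec D w k s : (w < T)%N -> (k < size (L w))%N ->
  inv_edge D w k s ->
  s.1 0%N < s.1 10 /\ W traverse_edge s (32 * n + 21) (inv_edge D w k.+1).
Proof.
move=> wT kL [l1 [l2 [Q [[LE sk] st QD [i10 [i24 i26]] [pQ mQ]]]]].
case: l2 LE i10 => [|v l2] LE i10; first by rewrite LE cats0 sk ltnn in kL.
split; first by rewrite i10 (st_0 st) ltr0n.
have vL : v \in L w by rewrite LE mem_cat mem_head orbT.
have /andP[v0 vT] := L_lt wT vL.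
have vl1 : v \notin l1.
  by have := L_uniq w; rewrite LE cat_uniq /= => /and3P[_ /norP[]].
have [x32 _] := xb_ge.
have hx : (32 <= hb /\ xb <= hb)%N by rewrite hbE ybE; clear -x32; lia.
case: s st i10 i24 i26 mQ => r N st /= i10 i24 i26 mQ; get_static st.
apply: (W_blk_seq (t1 := 32 * n + 19)); [by []| |by rewrite /=; clear; lia].
rewrite /exec_blk /step /=; usim; rewrite i10 r1 -natr1 addrK r0 addr0.
set r1' := upd _ 5 _.
have kr0 : keeps (fun a => a <> 5 /\ a <> 12) r r1'.
  by repeat (apply: keeps_upd; last by clear; lia).
have st1 : static (r1', N).
  apply: (static_keeps (s' := (_, _)) (P' := fun=> True) st kr0) => //.
  by clear -AbE; lia.
apply: (W_seq (t1 := 32 * n + 5) (t2 := 14) (decode_spec st1 vT _)); last by clear; lia.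
  by rewrite /= /r1' upd_eq.
move=> [r2' N2'] [/= j15 j16 _ kr kN].
have kr2 : keeps (fun a => keepsD a /\ a <> 12) r r2'.
  apply: (keeps_trans (P' := keepsD) _ kr) => [|a []//].
  by apply: (keeps_sub kr0) => a; rewrite /keepsD; clear; lia.
have st2 : static (r2', N2').
  apply: (static_keeps (s' := (_, _)) st kr2 kN) => a; last by rewrite /keepsDN; clear; lia.
  by rewrite /keepsD; clear -AbE xbE; lia.
have mQ2 : peel_mem (fun u => hits D u + (u \in l1))%N Q (r2', N2').
  apply: (peel_mem_keeps (s' := (_, _)) mQ kr2 kN) => [a|]; rewrite /keepsD /keepsDN.
    by clear -hx hbE; lia.
  by clear; lia.
have j12 : r2' 12 = v%:R.
  rewrite kr; last by rewrite /keepsD; clear -x32; lia.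
  by rewrite /r1'; usim.
have j24 : N2' 24 = (qb + (size D).+1)%N by rewrite kN ?i24 // /keepsDN; clear; lia.
have j26 : N2' 26 = w by rewrite kN ?i26 // /keepsDN; clear; lia.
have hw := hits_take Q (size D).+1 v.
clear kr0 kr2 kr kN st st1 mQ i10 i24 i26 N0 N1 N2 N3 N6 N7 N8 N9 N10 N11 N12 N13 r0 r1 r2 r3 r4 r1' r N.
move: r2' N2' st2 mQ2 j15 j16 j12 j24 j26 => r N st mQ j15 j16 j12 j24 j26.
get_static st.
set h := fun u => _ in pQ mQ.
have hE : (fun u => hits D u + (u \in rcons l1 v))%N = (fun u => h u + (u == v))%N.
  apply/funext => u; rewrite /h -addnA; congr addn; rewrite mem_rcons in_cons.
  by case: eqVneq => [->|_] /=; rewrite ?(negPf vl1) ?addn0.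
have sk' : size (rcons l1 v) = k.+1 by rewrite size_rcons sk.
have LE' : L w = rcons l1 v ++ l2 by rewrite cat_rcons.
have [mh mn mc mq me] := mQ; rewrite /= in mh mn mc mq me.
have cwE : (cb + v < nb)%N by clear -vT qbE nbE; lia.
apply: (W_cat (t1 := 8) (t2 := 6)) => //.
do 8 (apply: W_blk_step => //; rewrite /step /=; usim; rewrite ?(N11,j15,N13,j16,j26) ?mc ?mn //).
apply: W_nil.
have -> : nx (L w) v = (enc l2).+1 by rewrite LE nx_cat.
rewrite r1 -natr1 addrK; set r3' := upd _ 10 (enc l2)%:R; set N3' := upd _ 14 _.
have kN3 : keeps (fun a => a <> 14) N N3'.
  by repeat (apply: keeps_upd; last by clear; lia).
have kr3 : keeps (fun a => [/\ a <> 10, a <> 11 & a <> (cb + v)%N]) r r3'.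
  by repeat (apply: keeps_upd; last by case).
have st3 : static (r3', N3').
  apply: (static_keeps (s' := (_, _)) st kr3 kN3) => a; last by clear; lia.
  by move=> ax; split; clear -ax cbE hx AbE xbE; lia.
have mQ3 : peel_mem (fun u => h u + (u == v))%N Q (r3', N3').
  split=> /= [u uT|u u' uT u'T|u uT|i iQ|].
  - by rewrite kr3 ?mh //; split; clear -hx cbE uT; lia.
  - by rewrite kr3 ?mn //; split; clear -hx nbE qbE cbE vT; lia.
  - have [->|uv] := eqVneq u v.
      by rewrite /r3'; usim; rewrite addn1 -natr1 opprD addrA.
    rewrite addn0 kr3 ?mc //; split; try (clear -hx cbE; lia).
    by move=> /eqP; rewrite eqn_add2l (negPf uv).
  - by rewrite kr3 ?mq //; split; clear -hx qbE cbE vT; lia.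
  - by rewrite kN3 ?me.
have l11 : r3' 11 = (c0 v)%:R - (h v).+1%:R.
  by rewrite /r3'; usim; rewrite -natr1 opprD addrA.
have l12 : r3' 12 = v%:R by rewrite kr3 ?j12 //; split; clear -hx cbE; lia.
have l10 : r3' 10 = (enc l2)%:R by rewrite /r3' upd_eq.
have l25 : N3' 25 = (qb + size Q)%N by rewrite kN3 ?me.
have done_edge s' Q' : static s' -> take (size D).+1 Q' = rcons D w ->
    s'.1 10 = (enc l2)%:R -> s'.2 24 = N3' 24 -> s'.2 26 = N3' 26 ->
    peeling (fun u => h u + (u == v))%N Q' -> peel_mem (fun u => h u + (u == v))%N Q' s' ->
    inv_edge D w k.+1 s'.
  move=> st' QD' k10 k24 k26 pQ' mQ'; exists (rcons l1 v), l2, Q'.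
  by split; rewrite ?k24 ?k26 ?kN3 //= hE.
clearbody r3' N3'.
have skip : (c0 v != (h v).+1)%N -> W (Blk [::]) (r3', N3') 2 (inv_edge D w k.+1).
  move=> ne; apply: W_nil; apply: (done_edge _ Q) => //; exact: peeling_skip pQ ne.
have /= r0' := st_0 st3.
apply: W_ifr => /=; rewrite l11 r0' => cmp1; last first.
  apply: W_impl (skip _) _ _ => //; apply: contraTneq cmp1 => ->.
  by rewrite subrr ltxx.
apply: W_ifr => /=; rewrite l11 r0' => cmp2; last first.
  apply: skip; apply: contraTneq cmp2 => ->.
  by rewrite subrr ltxx.
have cv : c0 v = (h v).+1.
  apply/eqP; rewrite eqn_leq -!(ler_nat R).
  by move: cmp1 cmp2; rewrite subr_le0 subr_ge0 => -> ->.
(* [rcons D w] is a prefix of [Q], and [w] is the out-neighbour of [v] that is being counted now. *)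
have hv1 : ((h v).+1 <= hits Q v)%N.
  apply: leq_trans hw; rewrite QD /hits -cats1 count_cat /= vL.
  by rewrite /h /hits (negPf vl1) !addn0 addn1.
have pQ' := peeling_push pQ (introT andP (conj v0 vT)) cv hv1.
have QT := peeling_size pQ'; rewrite size_rcons in QT.
apply: W_blk => //; rewrite /exec_blk /step /=; usim; rewrite l12 l25.
have /= l3 := st_o st3; rewrite l3.
have kq : keeps (fun a => a <> qb + size Q)%N r3' (upd r3' (qb + size Q)%N v%:R).
  by apply: keeps_upd => //; apply.
have kq' : keeps (fun a => a <> 25) N3' (upd N3' 25 (qb + size Q + 1)%N).
  by apply: keeps_upd => //; apply.
apply: (done_edge _ (rcons Q v)) => //=.
- apply: (static_keeps (s' := (_, _)) st3 kq kq') => a; last by clear; lia.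
  by clear -hx AbE xbE qbE cbE; lia.
- have sQ : ((size D).+1 <= size Q)%N.
    by rewrite -(size_rcons D w) -QD size_take; clear; case: ltnP; lia.
  by rewrite -cats1 takel_cat.
- by rewrite kq //; clear -hx qbE cbE; lia.
- have [mh' mn' mc' mq' me'] := mQ3.
  rewrite /= in mh' mn' mc' mq' me'.
  split=> /= [u uT|u u' uT u'T|u uT|i|].
  + by rewrite kq ?mh' //; clear -cbE qbE uT; lia.
  + by rewrite kq ?mn' //; clear -nbE QT; lia.
  + by rewrite kq ?mc' //; clear -qbE uT; lia.
  + rewrite size_rcons ltnS leq_eqVlt nth_rcons => /predU1P[->|iQ].
      by rewrite upd_eq ltnn eqxx.
    by rewrite kq ?mq' // ?iQ //; clear -iQ; lia.
  + by rewrite upd_eq size_rcons; clear; lia.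
Qed.

Definition inv_vertex (D : seq nat) (s : state R) : Prop :=
  [/\ static s, s.2 24 = (qb + size D)%N & exists Q, [/\ take (size D) Q = D,
    peeling (hits D) Q & peel_mem (hits D) Q s]].

Definition vertex_cost (w : nat) : nat := 32 * n + 11 + size (L w) * (32 * n + 23).

Lemma traverse_vertex_spec D Q s : static s -> s.2 24 = (qb + size D)%N ->
  take (size D) Q = D -> peeling (hits D) Q -> peel_mem (hits D) Q s ->
  (size D < size Q)%N ->
  W traverse_vertex s (vertex_cost (nth 0%N Q (size D)))
    (inv_vertex (rcons D (nth 0%N Q (size D)))).
Proof.
set w := nth 0%N Q (size D) => st i24 QD pQ mQ DQ.
have wT : (w < T)%N by apply: (pl_lt pQ); exact: mem_nth.
have QT := peeling_size pQ.
have QDw : take (size D).+1 Q = rcons D w by rewrite (take_nth 0%N) // QD.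
have [x32 _] := xb_ge.
have hx : (32 <= hb /\ xb <= hb)%N by rewrite hbE ybE; clear -x32; lia.
case: s st i24 mQ => r N st /= i24 mQ; get_static st.
have /= mq := pm_queue mQ DQ.
apply: (W_blk_seq (t1 := 32 * n + 5 + 3 + (size (L w) * (32 * n + 23) + 1))); [by []| |]; last first.
  by rewrite /vertex_cost /=; clear; lia.
rewrite /exec_blk /step /= i24 mq -/w N3.
set r1' := upd r 5 _; set N1' := upd N 24 _.
have kr0 : keeps (fun a => a <> 5) r r1' by apply: keeps_upd => //; apply.
have kN0 : keeps (fun a => a <> 24) N N1' by apply: keeps_upd => //; apply.
have st1 : static (r1', N1').
  apply: (static_keeps (s' := (_, _)) st kr0 kN0) => a; last by clear; lia.
  by clear -AbE; lia.
apply: (W_seq (t1 := 32 * n + 5) (t2 := 3 + (size (L w) * (32 * n + 23) + 1)) (decode_spec st1 wT _)); last by clear; lia.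
  by rewrite /= /r1' upd_eq.
move=> [r2' N2'] [/= j15 j16 _ kr kN].
have kr2 : keeps keepsD r r2'.
  apply: (keeps_trans (P' := keepsD) _ kr) => //.
  by apply: (keeps_sub kr0) => a; rewrite /keepsD; clear; lia.
have kN2 : keeps (fun a => keepsDN a /\ a <> 24) N N2'.
  apply: (keeps_trans (P' := keepsDN) _ kN) => [|a []//].
  by apply: (keeps_sub kN0) => a [].
have st2 : static (r2', N2').
  apply: (static_keeps (s' := (_, _)) st kr2 kN2) => a; last by rewrite /keepsDN; clear; lia.
  by rewrite /keepsD; clear -AbE xbE; lia.
have mQ2 : peel_mem (hits D) Q (r2', N2').
  apply: (peel_mem_keeps (s' := (_, _)) mQ kr2 kN2) => [a|]; rewrite /keepsD /keepsDN.
    by clear -hx hbE; lia.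
  by clear; lia.
have j24 : N2' 24 = (qb + (size D).+1)%N.
  by rewrite kN ?/N1' ?upd_eq ?addn1 ?addnS // /keepsDN; clear; lia.
clear kr0 kr2 kr kN kN0 kN2 st st1 mQ mq i24 N0 N1 N2 N3 N6 N7 N8 N9 N10 N11 N12 N13 r0 r1 r2 r3 r4 r1' N1' r N j16.
move: r2' N2' st2 mQ2 j15 j24 => r N st mQ j15 j24; get_static st.
apply: (W_blk_seq (t1 := size (L w) * (32 * n + 23) + 1)); [by []| |by []].
rewrite /exec_blk /step /=; usim; rewrite j15 N2 addn0 N10.
have /= mh := pm_head mQ wT; rewrite mh.
set r1' := upd r 10 _; set N1' := upd _ 14 _.
have kr : keeps (fun a => a <> 10) r r1' by apply: keeps_upd => //; apply.
have kN : keeps (fun a => ~ (a = 26 \/ a = 14)) N N1'.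
  by repeat (apply: keeps_upd; last by clear; lia).
have st1 : static (r1', N1').
  apply: (static_keeps (s' := (_, _)) st kr kN) => a; last by clear; lia.
  by clear -AbE; lia.
apply: (W_forr (I := inv_edge D w) (k0 := 0%N) (k1 := size (L w)) (tb := 32 * n + 21)) => //.
- exists [::], (L w), Q; split=> //=.
  have -> : (fun v => hits D v + 0)%N = hits D.
    by apply/funext => v; rewrite addn0.
  split=> //; apply: (peel_mem_keeps (s' := (_, _)) mQ kr kN) => [a|]; last by clear; lia.
  by clear -hx; lia.
- by move=> k s /andP[_ kL]; exact: traverse_edge_spec.
- move=> s [l1 [l2 [Q' [[LE sl] st' QD' [k10 [k24 _]] [pQ' mQ']]]]].
  have l20 : l2 = [::].
    apply/nilP; have := congr1 size LE; rewrite size_cat sl /nilp; clear; lia.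
  rewrite l20 cats0 in LE k10 *.
  split; first by rewrite k10 (st_0 st').
  split=> //; rewrite ?size_rcons //; exists Q'.
  have <- : (fun v => hits D v + (v \in l1))%N = hits (rcons D w).
    by apply/funext => v; rewrite /hits -cats1 count_cat /= LE addn0.
  by split.
- by rewrite subn0; clear; lia.
Qed.

(** Potential for the amortised bound: each vertex is processed at most once, so list lengths add up
    to the number of edges instead of being bounded one by one. *)
Definition rest_cost (D : seq nat) : nat :=
  \sum_(w < T | val w \notin D) (vertex_cost w + 2) + 1.

Lemma traverse_loop D s : inv_vertex D s ->
  W (WhN 25 24 traverse_vertex) s (rest_cost D) (fun s' => static s' /\
    exists2 Q, peeling (hits Q) Q & s'.2 25 = (qb + size Q)%N).
Proof.
have [d] := ubnP (T - size D); elim: d D s => // d IH D s dD [st i24 [Q [QD pQ mQ]]].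
have QT := peeling_size pQ.
have DQ : (size D <= size Q)%N.
  by rewrite -[in leqLHS]QD size_take; clear; case: ltnP; lia.
case: (ltnP (size D) (size Q)) => [DQ'|QD']; last first.
  have DE : D = Q by rewrite -QD take_oversize.
  apply: W_whn_exit; last by rewrite /rest_cost addn1.
    by rewrite (pm_end mQ) i24; clear -QD'; lia.
  by split=> //; exists Q; [rewrite -{1}DE | exact: (pm_end mQ)].
have Wv := traverse_vertex_spec st i24 QD pQ mQ DQ'.
set w := nth 0%N Q (size D) in Wv.
have wT : (w < T)%N by apply: (pl_lt pQ); exact: mem_nth.
(* Entries of [Q] are distinct and [D] is a prefix, so the share of [w] in [rest_cost] has not been
   spent. *)
have wD : w \notin D.
  apply/negP; rewrite -QD => /(nthP 0%N)[i]; rewrite size_take_min leq_min => /andP[iD iQ].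
  rewrite nth_take // => /eqP; rewrite nth_uniq ?(pl_uniq pQ) // => /eqP iE.
  by rewrite iE ltnn in iD.
apply: (W_whn_step (t1 := vertex_cost w) (t2 := rest_cost (rcons D w))).
- by rewrite (pm_end mQ) i24 ltn_add2l.
- apply: W_impl Wv _ _ => // s1; apply: IH.
  by rewrite size_rcons; clear -dD QT DQ'; lia.
- rewrite {2}/rest_cost (bigD1 (Ordinal wT)) //=.
  suff -> : (\sum_(i < T | (val i \notin D) && (i != Ordinal wT)) (vertex_cost i + 2) =
      \sum_(i < T | val i \notin rcons D w) (vertex_cost i + 2))%N.
    by rewrite /rest_cost; clear; lia.
  by apply: eq_bigl => i; rewrite mem_rcons in_cons negb_or andbC.
Qed.

Lemma traverse_spec s : static s -> graph_mem L s.1 -> queue_zero s.1 ->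
  W traverse s (T * (32 * n + 13) + sources_total T L * (32 * n + 23) + 3)
    (fun s' => static s' /\
      exists2 Q, peeling (hits Q) Q & s'.2 25 = (qb + size Q)%N).
Proof.
case: s => r N st /= gm q0; get_static st; have [x32 _] := xb_ge.
have T1 : (0 < T)%N by rewrite TE expn_gt0.
apply: (W_blk_seq (t1 := rest_cost [::])); [by []| |]; last first.
  rewrite /rest_cost /= /vertex_cost.
  rewrite (eq_bigr (fun w : 'I_T => 32 * n + 13 + size (L w) * (32 * n + 23))%N); last first.
    by move=> w _; clear; lia.
  rewrite big_split /= sum_nat_const card_ord -big_distrl /= -/(sources_total T L).
  by clear; lia.
rewrite /exec_blk /step /=; usim; rewrite N12 N2 N3 addn0.
apply: traverse_loop; split=> /=.
- apply: (static_keeps (P := fun=> True) (P' := fun a => (a < 14)%N) st) => //=.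
  by repeat (apply: keeps_upd; last by clear; lia).
- by usim; rewrite addn0.
(* The queue starts with the sink alone, and the zero in its first cell already encodes it. *)
- exists [:: 0%N]; split=> //.
  + split=> // [v|||v vT].
    * by rewrite mem_seq1 => /eqP ->.
    * by exists [::].
    * by move=> v; rewrite mem_seq1 => ->.
    * by rewrite mem_seq1 leqNgt c0_gt0 //; case/andP: vT; case: v.
  + have [mh mn mc] := gm; split=> /=.
    * exact: mh.
    * exact: mn.
    * by move=> v vT; rewrite mc // subr0.
    * by case=> // _; rewrite addn0 -[qb]addn0 q0.
    * by usim.
Qed.
End Traverse.

(** * Relocating the input and laying out the memory *)

Lemma save_registers_spec j k b s : (j + k <= 16)%N -> (16 <= b)%N ->
  s.2 3 = 1%N -> s.2 14 = (b + j)%N ->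
  W (Blk (save_registers j k)) s (2 * k) (fun s' : state R => [/\ s'.2 14 = (b + j + k)%N,
    forall i, (i < k)%N -> s'.1 (b + j + i)%N = s.1 (j + i)%N,
    keeps (fun a => ~ (b + j <= a < b + j + k)%N) s.1 s'.1 &
    keeps (fun a => a <> 14) s.2 s'.2]).
Proof.
elim: k j s => [|k IH] j [r N] jk b16 /= i3 i14; first by apply: W_nil; rewrite addn0.
rewrite /save_registers /= -/(save_registers j.+1 k).
rewrite (_ : 2 * k.+1 = (2 * k).+2)%N; last by clear; lia.
apply: W_blk_step => //; apply: W_blk_step => //; rewrite /step /= i14 i3.
apply: W_impl (IH j.+1 _ _ b16 _ _) _ _ => //=.
- by clear -jk; lia.
- by usim; clear; lia.
- move=> s' [j14 jr kr kN]; split.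
  + by rewrite j14; clear; lia.
  + case=> [|i] ik.
      rewrite kr; last by clear; lia.
      by rewrite addn0 upd_eq addn0.
    rewrite (_ : b + j + i.+1 = b + j.+1 + i)%N; last by clear; lia.
    rewrite jr // upd_ne; last by clear -jk ik b16; lia.
    by congr r; clear; lia.
  + move=> a Pa; rewrite kr; last by move: Pa; clear; lia.
    by rewrite upd_ne //; apply/eqP; move: Pa; clear; lia.
  + by move=> a Pa; rewrite kN // upd_ne //; apply/eqP.
Qed.

Lemma setup_spec (s : state R) : (0 < n)%N -> s.2 0 = n -> s.2 1 = m ->
  (forall k, (1 < k)%N -> s.2 k = 0%N) ->
  (forall (k : 'I_m) (i j : 'I_n), s.1 (k * n * n + i * n + j)%N = A k i j) ->
  (forall a, (m * n * n <= a)%N -> s.1 a = 0) ->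
  W setup s (10 * n + 4 * m + 6 * (m * n * n) + 160) (fun s' => static s' /\
    forall a, (hb <= a)%N -> s'.1 a = 0).
Proof.
case: s => r N n0 /= i0 i1 iN ir rz.
have [M MD] : exists M, M = (m * n * n)%N by exists (m * n * n)%N.
have MAb : Ab = (M + 16)%N by rewrite AbE MD.
have Mxb : xb = (Ab + (M + 16))%N by rewrite xbE MD.
rewrite -MD in rz *; have ME : M = (m * (n * n))%N by rewrite MD mulnA.
apply: (W_blk_seq (t1 := 10 * n + 4 * m + 6 * M + 159)); [by []| |by rewrite /=; clear; lia].
rewrite /exec_blk /step /=.
(* Without multiplication of index registers, n ^ 2 and then m * n ^ 2 are obtained by repeated
   addition. *)
pose I2 k (s : state R) := s.1 = r /\ [/\ s.2 14 = k, s.2 4 = (k * n)%N, s.2 3 = 1%N &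
  keeps (fun a => ~ (a = 14 \/ a = 4 \/ a = 3)%N) N s.2].
apply: (W_seq (t1 := 4 * n + 1) (t2 := 6 * n + 4 * m + 6 * M + 158) (Q1 := I2 n)); last by clear; lia.
  apply: (W_forn (I := I2) (k0 := 0%N) (k1 := n) (tb := 2)) => //.
  - split=> //=; usim; rewrite !iN //; split=> //.
    by apply: keeps_upd; last by clear; lia.
  - move=> k [r' N'] /andP[_ kn] [/= -> [j14 j4 j3 kN]].
    have j0 : N' 0 = n by rewrite kN ?i0 //; clear; lia.
    rewrite j0 j14; split=> //; apply: W_blk => //; rewrite /exec_blk /step /=; usim.
    rewrite j0 j14 j4 j3; split=> //=; usim; split=> //.
    + by clear; lia.
    + by rewrite mulSn addnC.
    + by repeat (apply: keeps_upd; last by clear; lia).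
  - move=> s J; split=> //; case: J => _ [-> _ _ kN].
    by rewrite kN ?i0 //; clear; lia.
  - by clear; lia.
move=> [_ N2'] [/= -> [_ j4 j3 kN2]].
apply: (W_blk_seq (t1 := 6 * n + 4 * m + 6 * M + 157)); [by []| |by rewrite /=; clear; lia].
rewrite /exec_blk /step /=.
pose I3 k (s : state R) := s.1 = r /\ [/\ s.2 14 = k, s.2 5 = (k * (n * n))%N,
  s.2 3 = 1%N, s.2 4 = (n * n)%N &
  keeps (fun a => ~ (a = 14 \/ a = 5 \/ a = 4 \/ a = 3)%N) N s.2].
apply: (W_seq (t1 := 4 * m + 1) (t2 := 6 * n + 6 * M + 156) (Q1 := I3 m)); last by clear; lia.
  apply: (W_forn (I := I3) (k0 := 0%N) (k1 := m) (tb := 2)) => //.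
  - split=> //=; usim; split=> //.
      by rewrite kN2 ?iN //; clear; lia.
    apply: keeps_upd; last by clear; lia.
    by apply: (keeps_sub kN2); clear; lia.
  - move=> k [r' N'] /andP[_ kn] [/= -> [l14 l5 l3 l4 kN]].
    have l1 : N' 1 = m by rewrite kN ?i1 //; clear; lia.
    rewrite l1 l14; split=> //; apply: W_blk => //; rewrite /exec_blk /step /=; usim.
    rewrite l5 l14 l4 l3; split=> //=; usim; split=> //.
    + by clear; lia.
    + by rewrite mulSn addnC.
    + repeat (apply: keeps_upd; last by clear; lia); exact: kN.
  - move=> s J; split=> //; case: J => _ [-> _ _ _ kN].
    by rewrite kN ?i1 //; clear; lia.
  - by clear; lia.
move=> [_ N3'] [/= -> [_ j5 k3 _ kN3]]; rewrite -ME in j5.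
apply: (W_blk_seq (t1 := 6 * n + 6 * M + 153)); [by []| |by rewrite /=; clear; lia].
rewrite /exec_blk /step /=; usim.
have k2 : N3' 2 = 0%N by rewrite kN3 ?iN //; clear; lia.
rewrite j5 k2 addn0 -MAb.
set N4' := upd _ 14 Ab.
have A16 : (16 <= Ab)%N by rewrite MAb; clear; lia.
apply: (W_seq (t1 := 32) (t2 := 6 * n + 6 * M + 121) (save_registers_spec (b := Ab) (j := 0) (k := 16) _ A16 _ _)) => //=;
  [by rewrite /N4' upd_eq addn0 | | by clear; lia].
move=> [r5' N5'] [/= l14 lr kr5 kN5]; rewrite addn0 in l14 lr kr5.
have l15 : N5' 15 = 16 by rewrite kN5 // /N4'; usim.
have l3 : N5' 3 = 1%N by rewrite kN5 // /N4'; usim.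
have l5 : N5' 5 = M by rewrite kN5 // /N4'; usim.
have l7 : N5' 7 = Ab by rewrite kN5 // /N4'; usim.
have kN5' : keeps (fun a => ~ (2 < a < 16)%N) N N5'.
  apply: keeps_trans (_ : keeps (fun a => ~ (2 < a < 16)%N) N N4') kN5 _; last by clear; lia.
  rewrite /N4'; repeat (apply: keeps_upd; last by clear; lia).
  by apply: (keeps_sub kN3); clear; lia.
clear kN2 kN3 j4 j3 j5 k3 k2 kN5 N2' N3' N4' I2 I3.
pose I6 k (s : state R) := [/\ s.2 15 = k, s.2 14 = (Ab + k)%N,
  forall a, (a < k)%N -> s.1 (Ab + a)%N = r a,
  forall a, (16 <= a < Ab)%N \/ (Ab + k <= a)%N -> s.1 a = r a &
  keeps (fun a => ~ (a = 14 \/ a = 15)%N) N5' s.2].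
(* The copy resumes at cell 16, so for inputs of at most 16 entries the loop ends at once; the saved
   cells beyond such an input are zero. *)
apply: (W_seq (t1 := 6 * M + 97) (t2 := 6 * n + 24) (Q1 := I6 (maxn M 16))); last by clear; lia.
  apply: (W_forn (I := I6) (k0 := 16) (k1 := maxn M 16) (tb := 4)) => //.
  - by clear; lia.
  - split=> //= a Pa.
    by rewrite kr5 //; move: Pa; clear; lia.
  - move=> k [r' N'] /andP[k16 kM] [/= m15 m14 mr mo kN].
    have m5 : N' 5 = M by rewrite kN ?l5 //; clear; lia.
    have m3 : N' 3 = 1%N by rewrite kN ?l3 //; clear; lia.
    have kM' : (k < M)%N by move: k16 kM; clear; lia.
    rewrite m5 m15; split=> //.
    have rk : r' k = r k by apply: mo; left; clear -k16 kM' MAb; lia.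
    apply: W_blk => //; rewrite /exec_blk /step /=; usim; rewrite m15 m14 m3 rk.
    split=> /=; usim.
    + by rewrite addn1.
    + by clear; lia.
    + move=> a; rewrite ltnS leq_eqVlt => /predU1P[->|ak]; first by rewrite upd_eq.
      by rewrite !upd_ne ?mr //; clear -ak A16 k16; lia.
    + by move=> a Pa; rewrite !upd_ne ?mo //; clear -Pa k16 A16; lia.
    + by repeat (apply: keeps_upd; last by clear; lia).
  - move=> s J; split=> //; case: J => -> _ _ _ kN.
    by rewrite kN ?l5 //; clear; lia.
  - by clear; lia.
move=> [r6' N6'] [/= _ _ mr mo kN6].
have mat6 (k : 'I_m) (i j : 'I_n) : r6' (Ab + (k * n * n + i * n + j))%N = A k i j.
  by rewrite mr ?ir //; have := mat_index_lt k i j; rewrite -MD; clear; lia.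
have zero6 a : (xb <= a)%N -> r6' a = 0.
  by move=> xa; rewrite mo ?rz //; clear -xa Mxb MAb; lia.
clear mr mo lr kr5 l14 l15 I6 r5' ir rz.
apply: (W_blk_seq (t1 := 6 * n + 17)); [by []| |by rewrite /=; clear; lia].
rewrite /exec_blk /step /=.
have x32 : (32 <= xb)%N by clear -Mxb MAb; lia.
set r7 := upd _ 4 _; set N7 := upd _ 14 _.
have kr7 : keeps (fun a => (16 <= a)%N) r6' r7.
  by repeat (apply: keeps_upd; last by clear; lia).
have kN7 : keeps (fun a => ~ (a = 14 \/ a = 6 \/ a = 15)%N) N5' N7.
  repeat (apply: keeps_upd; last by clear; lia).
  by apply: (keeps_sub kN6); clear; lia.
pose I8 k (s : state R) := [/\ s.2 14 = k /\ s.2 6 = (3 ^ k)%N, s.1 4 = (3 ^ k)%:R,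
  [/\ s.1 0%N = 0, s.1 1%N = 1, s.1 2 = 2 & s.1 3 = 3],
  keeps (fun a => (16 <= a)%N) r6' s.1 &
  keeps (fun a => ~ (a = 14 \/ a = 6 \/ a = 15)%N) N5' s.2].
apply: (W_seq (t1 := 6 * n + 1) (t2 := 8) (Q1 := I8 n)); last by clear; lia.
  apply: (W_forn (I := I8) (k0 := 0%N) (k1 := n) (tb := 4)) => //.
  - move=> k [r' N'] /andP[_ kn] [/= [n14 n6] n4 [z0 z1 z2 z3] kr kN].
    have m0 : N' 0 = n by rewrite kN ?kN5' ?i0 //; clear; lia.
    have m3 : N' 3 = 1%N by rewrite kN ?l3 //; clear; lia.
    rewrite m0 n14; split=> //.
    apply: W_blk => //; rewrite /exec_blk /step /=; usim; rewrite n14 n6 n4 m3 z3.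
    split=> /=; usim.
    + by rewrite addn1 expnS; split=> //; clear; lia.
    + by rewrite expnSr natrM.
    + by split.
    + by repeat (apply: keeps_upd; last by clear; lia).
    + by repeat (apply: keeps_upd; last by clear; lia).
  - move=> s J; split=> //; case: J => -[-> _] _ _ _ kN.
    by rewrite kN ?kN5' ?i0 //; clear; lia.
  - by clear; lia.
move=> [r8 N8] [/= [_ n6] n4 [z0 z1 z2 z3] kr8 kN8].
have o0 : N8 0 = n by rewrite kN8 ?kN5' ?i0 //; clear; lia.
have o1 : N8 1 = m by rewrite kN8 ?kN5' ?i1 //; clear; lia.
have o2 : N8 2 = 0%N by rewrite kN8 ?kN5' ?iN //; clear; lia.
have o3 : N8 3 = 1%N by rewrite kN8 ?l3 //; clear; lia.
have o5 : N8 5 = M by rewrite kN8 ?l5 //; clear; lia.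
have o7 : N8 7 = Ab by rewrite kN8 ?l7 //; clear; lia.
clear kN8 kN7 kN6 kN5' N7 l3 l5 l7.
apply: W_blk => //; rewrite /exec_blk /step /=.
do 8 (usim; rewrite ?(o0, o5, o7, n6)).
rewrite -addnA -Mxb -TE -ybE -hbE -cbE -qbE -nbE.
split=> /=; last first.
  move=> a ha; have xa : (xb <= a)%N by move: ha; clear -hbE ybE; lia.
  by rewrite kr8 ?zero6 //; clear -xa x32; lia.
split=> /=; usim => //; try by rewrite TE.
by move=> k i j; rewrite kr8 ?mat6 //; clear -A16; lia.
Qed.

(** * Total cost, and reading the answer off the final queue *)

Hypothesis m_gt0 : (0 < m)%N.

Lemma adjacency_full L : adjacency T 0 L -> forall w, (w < T)%N -> forall v,
  v \in L w <-> (0 < v < T)%N /\ exists k, succ A k v = w.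
Proof.
move=> [_ Lm _] w wT v; rewrite Lm // /edges_below.
by split=> [[//|[_ [] //]]|h]; left.
Qed.

Lemma deg_count L v : deg T L v = count (fun w => v \in L w) (iota 0 T).
Proof.
rewrite /deg -(big_mkord xpredT (fun w => nat_of_bool (v \in L w))) -sum1_count.
rewrite /index_iota subn0 [RHS]big_mkcond /=.
by apply: eq_bigr => w _; case: (v \in L w).
Qed.

(** Makes all initial counters positive: a counter starting at 0 would meet its threshold without
    the vertex ever being queued. *)
Lemma deg_gt0 L v : adjacency T 0 L -> (0 < v < T)%N -> (0 < deg T L v)%N.
Proof.
move=> adj vT; rewrite deg_count -has_count; apply/hasP.
have wT : (succ A (Ordinal m_gt0) v < T)%N by rewrite TE; exact: succ_lt.
exists (succ A (Ordinal m_gt0) v); first by rewrite mem_iota.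
by apply/(adjacency_full adj wT); split=> //; exists (Ordinal m_gt0).
Qed.

Definition main_cost : nat :=
  (10 * n + 4 * m + 6 * (m * n * n) + 160) + T * (32 * n + m * build_cost + 12) +
  (T * (32 * n + 13) + T * m * (32 * n + 23) + 3) + 1.

Lemma main_spec (s : state R) : s.2 0 = n -> s.2 1 = m ->
  (forall k, (1 < k)%N -> s.2 k = 0%N) ->
  (forall (k : 'I_m) (i j : 'I_n), s.1 (k * n * n + i * n + j)%N = A k i j) ->
  (forall a, (m * n * n <= a)%N -> s.1 a = 0) ->
  W (main all) s main_cost (fun s' => exists L Q, [/\ adjacency T 0 L,
    peeling L (hits L Q) Q, s'.2 14 = (qb + T)%N & s'.2 25 = (qb + size Q)%N]).
Proof.
move=> i0 i1 iN ir rz.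
apply: (W_seq (setup_spec n_gt0 i0 i1 iN ir rz)
  (t2 := T * (32 * n + m * build_cost + 12) +
         (T * (32 * n + 13) + T * m * (32 * n + 23) + 3) + 1)); last first.
  by rewrite /main_cost; clear; lia.
move=> s1 [st1 z1].
apply: (W_seq (build_spec st1 z1)
  (t2 := (T * (32 * n + 13) + T * m * (32 * n + 23) + 3) + 1)); last by clear; lia.
move=> s2 [st2 _ q2 [L adj gm]].
have L_lt w v : (w < T)%N -> v \in L w -> (0 < v < T)%N.
  by move=> wT /(adjacency_full adj wT)[].
have c0_gt0 v : (0 < v < T)%N -> (0 < threshold all (deg T L v))%N.
  by move=> vT; rewrite /threshold; case: (all); rewrite ?lt0b deg_gt0.
have Lt : (sources_total T L <= T * m)%N.
  by have := adj_total adj; rewrite addn0 => /leq_trans; apply; rewrite leq_mul2r leq_pred orbT.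
apply: (W_seq (t2 := 1) (traverse_spec (adj_uniq adj) L_lt c0_gt0 st2 gm q2)); last first.
  by rewrite leq_add2r leq_add2r leq_add2l leq_mul2r Lt orbT.
move=> [r N] [/= st3 [Q pQ i25]]; get_static st3.
apply: W_blk => //; rewrite /exec_blk /step /=; exists L, Q; split=> //; usim => //.
by rewrite N12 N6.
Qed.

(** Each monomial of the cost is at most T * m * n ^ 2, and the coefficients add up to 397; the 2
    pays for the final test and the halt. *)
Lemma main_cost_le : (main_cost + 2 <= 500 * (3 ^ n * m * n ^ 2))%N.
Proof.
rewrite /main_cost /build_cost -TE -mulnn.
have T1 : (0 < T)%N by rewrite TE expn_gt0.
have key a b c : (a <= T -> b <= m -> c <= n * n -> a * b * c <= T * m * (n * n))%N.
  by move=> aT bm cn; rewrite !leq_mul.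
have nn : (n <= n * n)%N by rewrite leq_pmulr.
have nn1 : (1 <= n * n)%N by rewrite muln_gt0 n_gt0.
have := key 1 1 1 T1 m_gt0 nn1; have := key 1 1 n T1 m_gt0 nn.
have := key 1 m 1 T1 (leqnn m) nn1; have := key 1 m (n * n) T1 (leqnn m) (leqnn _).
have := key T 1 1 (leqnn T) m_gt0 nn1; have := key T 1 n (leqnn T) m_gt0 nn.
have := key T m 1 (leqnn T) (leqnn m) nn1; have := key T m n (leqnn T) (leqnn m) nn.
rewrite !mul1n !muln1 mulnDr !(mulnDr T) !(mulnDr m) !(mulnDr T) !mulnA.
clear; lia.
Qed.

(** By counting: the out-neighbours in the duplicate-free [Q] form a subset of all out-neighbours,
    so equal cardinality forces equality. *)
Lemma hits_all L Q v : uniq Q -> (forall w, w \in Q -> (w < T)%N) ->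
  (deg T L v <= hits L Q v)%N -> forall w, (w < T)%N -> v \in L w -> w \in Q.
Proof.
move=> Qu Qlt; rewrite deg_count /hits -!size_filter => sz w wT vw.
have := @uniq_min_size _ [seq w <- Q | v \in L w] [seq w <- iota 0 T | v \in L w]
  (filter_uniq _ Qu) _ sz.
case=> [u|_ E]; first by rewrite !mem_filter mem_iota /= => /andP[-> /Qlt].
by have := E w; rewrite !mem_filter vw mem_iota /= wT.
Qed.

Lemma all_hits L Q v : (forall w, (w < T)%N -> v \in L w -> w \in Q) ->
  (deg T L v <= hits L Q v)%N.
Proof.
move=> LQ; rewrite deg_count /hits -!size_filter; apply: uniq_leq_size.
  by rewrite filter_uniq ?iota_uniq.
by move=> w; rewrite !mem_filter mem_iota /= => /andP[vw wT]; rewrite vw LQ.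
Qed.

(** [Q] is duplicate-free with entries below [T], so its length alone tells whether everything was
    peeled; this is the final test of the program. *)
Lemma peeling_complete L Q : peeling L (hits L Q) Q ->
  (T <= size Q)%N <-> (forall v, (v < 3 ^ n)%N -> v \in Q).
Proof.
move=> pQ; have sub : {subset Q <= iota 0 T}.
  by move=> v /(pl_lt pQ) vT; rewrite mem_iota.
split=> [TQ v vT|inQ].
  have [] := uniq_min_size (pl_uniq pQ) sub; first by rewrite size_iota.
  by move=> _ ->; rewrite mem_iota /= TE.
rewrite -[X in (X <= _)%N](size_iota 0); apply: uniq_leq_size (iota_uniq _ _) _ => v.
by rewrite mem_iota /= TE => /inQ.
Qed.

(** The rank field says that enough out-neighbours come earlier in [Q]: all of them when the
    threshold is the degree, some one when it is 1. The closure field gives the opposite statement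
    for vertices left out. *)
Lemma peeling_decides L Q : adjacency T 0 L -> peeling L (hits L Q) Q ->
  (T <= size Q)%N <-> (if all then problem1 A else problem2 A).
Proof.
move=> adj pQ; rewrite (peeling_complete pQ).
have [[q QE] full] := (pl_head pQ, adjacency_full adj).
have Qu := pl_uniq pQ; have Qlt := pl_lt pQ; have Qr := pl_rank pQ; have Qc := pl_closed pQ.
have Qlt' v : v \in 0%N :: q -> (v < 3 ^ n)%N by rewrite -QE -TE; exact: Qlt.
have sT k v : (succ A k v < T)%N by rewrite TE; exact: succ_lt.
have v_gt0 v : v \notin Q -> (0 < v)%N by case: v => //; rewrite QE mem_head.
have edge k v : (0 < v < T)%N -> v \in L (succ A k v).
  by move=> vT; apply/full => //; split=> //; exists k.
have in_take i w : w \in take i Q -> (index w Q < i)%N.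
  move=> wi; have wQ := mem_take wi; case: (leqP (size Q) i) => iQ.
    by rewrite (leq_trans _ iQ) // index_mem.
  by rewrite -in_take_leq // ltnW.
have take_uniq' i : uniq (take i Q) by exact: take_uniq.
case: all Qr Qc => Qr Qc; rewrite QE in Qr Qc in_take *.
- apply: (problem1P Aadm) => //; first by rewrite -QE.
  + move=> v vQ v0 k; apply: in_take; rewrite -QE.
    have vT : (0 < v < T)%N by rewrite lt0n v0 Qlt // QE.
    apply: (hits_all (v := v) (take_uniq' _) _ _ (sT k v) (edge k v vT)).
      by move=> w /mem_take; exact: Qlt.
    by rewrite QE; exact: Qr.
  + move=> v; rewrite -TE -QE => vT vQ; have v0 := v_gt0 _ vQ.
    have [/existsP[k kQ]|/existsPn allQ] := boolP [exists k, succ A k v \notin Q].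
      by exists k.
    have := Qc v; rewrite v0 vT -QE (negPf vQ) => /(_ isT) /esym/negP[].
    apply: all_hits => w wT /(full w wT)[_ [k <-]].
    by have := allQ k; rewrite negbK.
- apply: (problem2P Aadm) => //; first by rewrite -QE.
  + move=> v vQ v0; have vT : (0 < v < T)%N by rewrite lt0n v0 Qlt // QE.
    have := Qr v vQ v0; rewrite /threshold deg_gt0 // /hits -has_count.
    move=> /hasP[w wQ]; have wT : (w < T)%N by rewrite Qlt // QE (mem_take wQ).
    by move=> /(full w wT)[_ [k kw]]; exists k; rewrite kw; exact: in_take.
  + move=> v; rewrite -TE -QE => vT vQ k; have v0 := v_gt0 _ vQ.
    have vT' : (0 < v < T)%N by rewrite v0 vT.
    apply: contra vQ => kQ; rewrite QE Qc // /threshold deg_gt0 //.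
    rewrite /hits -has_count; apply/hasP; exists (succ A k v); first by rewrite -QE.
    exact: edge.
Qed.
End Routines.

Lemma decider_correct (R : realType) (all : bool) :
  decides_within (decider all)
    (fun n m (A : 'I_m -> 'M[R]_n) => if all then problem1 A else problem2 A)
    (fun n m => 500 * (3 ^ n * m * n ^ 2))%N.
Proof.
move=> n m A n0 m0 Aadm [p r N] [/= -> [i0 i1 iN] ir rz].
have [t [[r' N'] [tc [L [Q [adj pQ i14 i25]]] st]]] :=
  main_spec erefl erefl erefl erefl erefl erefl erefl erefl Aadm n0 all m0
    (s := (r, N)) i0 i1 iN ir rz.
have cost := main_cost_le erefl n0 m0.
(* After the [t] steps of [main], the conditional jump and the [Halt] take the two remaining
   units. *)
have [f ->] : exists f, (500 * (3 ^ n * m * n ^ 2) = t + f.+2)%N.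
  by exists (500 * (3 ^ n * m * n ^ 2) - t - 2)%N; move: tc cost; clear; lia.
exists (3 ^ n <= size Q)%N; split; last first.
  by rewrite -(peeling_decides erefl Aadm n0 m0 adj pQ).
rewrite (st (decider all) 0); last first.
  by exists [::], [:: JLeN 14 25 (csize (main all)).+2; Halt false; Halt true].
have onth_tail i : onth (decider all) (csize (main all) + i) =
    onth [:: JLeN 14 25 (csize (main all)).+2; Halt false; Halt true] i.
  rewrite /decider !onthE map_cat nth_cat size_map size_compile.
  by rewrite ltnNge leq_addr addKn.
have := onth_tail 0; rewrite addn0 add0n => /run_jlen ->.
rewrite i14 i25 leq_add2l; case: ifP => _.
  by have := onth_tail 2; rewrite addn2 => /run_halt ->.
by have := onth_tail 1%N; rewrite addn1 => /run_halt ->.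
Qed.

Theorem theorem2 (R : realType) :
  exists (P1 P2 : program) (C : nat),
    decides_within P1 (@problem1 R) (fun n m => C * (3 ^ n * m * n ^ 2))%N /\
    decides_within P2 (@problem2 R) (fun n m => C * (3 ^ n * m * n ^ 2))%N.
Proof.
exists (decider true), (decider false), 500.
by split; [exact: (decider_correct true) | exact: (decider_correct false)].
Qed.
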